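(* Let $X$ be a real Banach space, $u,f_j,g_i\colon X\to\mathbb{R}$, $j\in J=\{1,\dots,l\}$, $i\in I=\{1,\dots,m\}$, and consider the problem $$(\mathcal{P})\qquad \min\ u(x)\quad\text{subject to } f_j(x)=0,\ j\in J,\quad g_i(x)\le0,\ i\in I.$$ Let the following assumptions be valid: 1. $\overline{x}$ is a locally optimal solution of $(\mathcal{P})$; 2. $u$ is quasidifferentiable at $\overline{x}$ and Lipschitz continuous near this point; 3. $f_j$, $j\in J$, and $g_i$, $i\in I$, are quasidifferentiable in a neighbourhood of $\overline{x}$, and there exist quasidifferential mappings $\mathscr{D}f_j(\cdot)=[\underline{\partial}f_j(\cdot),\overline{\partial}f_j(\cdot)]$, $j\in J$, and $\mathscr{D}g_i(\cdot)=[\underline{\partial}g_i(\cdot),\overline{\partial}g_i(\cdot)]$, $i\in I$, defined in a neighbourhood of $\overline{x}$ and outer semicontinuous at this point; 4. q.d.-MFCQ holds at $\overline{x}$ (for these quasidifferentials). Let $\Psi_c(x)=u(x)+c\big(\sum_{j=1}^l|f_j(x)|+\sum_{i=1}^m\max\{g_i(x),0\}\big)$ for $c\ge0$. Then there exists $c^*\ge0$ such that for any $c\ge c^*$ one has $$\mathbb{O}\in\underline{\partial}\Psi_c(\overline{x})+w^*\quad\forall w^*\in\overline{\partial}\Psi_c(\overline{x}),$$ where $[\underline{\partial}\Psi_c(\overline{x}),\overline{\partial}\Psi_c(\overline{x})]$ is any quasidifferential of $\Psi_c$ at $\overline{x}$. Moreover, for any $w_0^*\in\overline{\partial}u(\overline{x})$,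 $v_j^*\in\underline{\partial}f_j(\overline{x})$, $w_j^*\in\overline{\partial}f_j(\overline{x})$, $j\in J$, and $z_i^*\in\overline{\partial}g_i(\overline{x})$, $i\in I$, there exist $\underline{\mu}_j,\overline{\mu}_j,\lambda_i\ge0$ such that $\lambda_ig_i(\overline{x})=0$ for all $i\in I$ and $$\mathbb{O}\in\underline{\partial}u(\overline{x})+w_0^*-\sum_{j=1}^l\underline{\mu}_j\big(v_j^*+\overline{\partial}f_j(\overline{x})\big)+\sum_{j=1}^l\overline{\mu}_j\big(\underline{\partial}f_j(\overline{x})+w_j^*\big)+\sum_{i=1}^m\lambda_i\big(\underline{\partial}g_i(\overline{x})+z_i^*\big).$$ In addition, one can choose $\underline{\mu}_j,\overline{\mu}_j,\lambda_i$ in such a way that $\max\{\underline{\mu}_j+\overline{\mu}_j,\lambda_i\}\le c^*$ for all $i\in I$ and $j\in J$, i.e. the multipliers are bounded by a constant which is the same for all $w_0^*\in\overline{\partial}u(\overline{x})$, $v_j^*\in\underline{\partial}f_j(\overline{x})$, $w_j^*\in\overline{\partial}f_j(\overline{x})$, $j\in J$, and $z_i^*\in\overline{\partial}g_i(\overline{x})$, $i\in I$.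
   Context: $X^*$ is the topological dual of $X$, $\mathbb{O}$ is the zero vector, sums of sets are Minkowski sums. Quasidifferentiability. A real-valued function $f$ defined on an open subset of $X$ is quasidifferentiable at $x$ if for all $h\in X$ the finite limit $f'(x,h)=\lim_{\alpha\to+0}(f(x+\alpha h)-f(x))/\alpha$ exists and there is a pair $\mathscr{D}f(x)=[\underline{\partial}f(x),\overline{\partial}f(x)]$ (called a quasidifferential of $f$ at $x$; it is not unique) of (nonempty) convex weak$^*$ compact subsets of $X^*$ with $$f'(x,h)=\max_{v^*\in\underline{\partial}f(x)}\langle v^*,h\rangle+\min_{w^*\in\overline{\partial}f(x)}\langle w^*,h\rangle\quad\forall h\in X.$$ Whenever a function is said to be quasidifferentiable at a point, a quasidifferential at that point is assumed given. If $u,f_j,g_i$ are quasidifferentiable at $\overline{x}$, then so is $\Psi_c$. A quasidifferential mapping $\mathscr{D}f(\cdot)$ defined in a neighbourhood $U$ of $x$ is outer semicontinuous at $x$ if for any (norm) open sets $V_1,V_2\subset X^*$ with $\underline{\partial}f(x)\subset V_1$, $\overline{\partial}f(x)\subset V_2$ there is $\delta>0$ such that $\underline{\partial}f(x')\subset V_1$ and $\overline{\partial}f(x')\subset V_2$ for all $x'\in U$ with $\|x'-x\|<\delta$. q.d.-MFCQ. Put $[\mathscr{D}f_j(\overline{x})]^+=\underline{\partial}f_j(\overline{x})+\overline{\partial}f_j(\overline{x})$, $[\mathscr{D}g_i(\overline{x})]^+=\underline{\partial}g_i(\overline{x})+\overline{\partial}g_i(\overline{x})$, $I(\overline{x})=\{i\in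 I: g_i(\overline{x})=0\}$. For $F=(f_1,\dots,f_l)^T\colon X\to\mathbb{R}^l$ ($\mathbb{R}^l$ with the Euclidean norm $|\cdot|$) and $y^*=(y_1,\dots,y_l)^T\in\mathbb{R}^l$ put $[\mathscr{D}F(\overline{x};y^* )]^+=\sum_{j=1}^ly_j[\mathscr{D}f_j(\overline{x})]^+$. q.d.-MFCQ (the Mangasarian-Fromovitz constraint qualification in terms of quasidifferentials) holds at $\overline{x}$ if $$\inf_{|y^*|=1}\inf\{\|v^*\|: v^*\in[\mathscr{D}F(\overline{x};y^* )]^+\}>0$$ and there exists $\overline{h}\in X$ such that $\langle v^*,\overline{h}\rangle=0$ for all $v^*\in[\mathscr{D}F(\overline{x};y^* )]^+$ and all $y^*\in\mathbb{R}^l$, while $\langle v^*,\overline{h}\rangle<0$ for all $v^*\in[\mathscr{D}g_i(\overline{x})]^+$ and $i\in I(\overline{x})$. *)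

(* Defs.v *)
From HB Require Import structures.
From mathcomp Require Import all_boot all_order all_algebra.
From mathcomp Require Import all_classical all_reals all_analysis.

Set Implicit Arguments.
Unset Strict Implicit.
Unset Printing Implicit Defensive.

Import Order.TTheory GRing.Theory Num.Theory.
Import numFieldNormedType.Exports.

Local Open Scope classical_set_scope.
Local Open Scope ring_scope.

Section Dual.
Context {R : realType} (X : normedModType R).

Definition dual_pred : {pred X -> R^o} :=
  mem [set f : X -> R^o | linear f /\ continuous f].

Lemma dual_pred_submod_closed : submod_closed dual_pred.
Proof.
split=> [|a f g]; rewrite !inE/=.
  split; last exact: cst_continuous.
  by move=> k x y; rewrite /GRing.zero/= scaler0 addr0.
move=> [lf cf] [lg cg]; split.
  move=> k x y; rewrite !fctE lf lg scalerDr scalerDr !scalerA [a * k]mulrC.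
  by rewrite addrACA.
move=> x; apply: cvgD; last exact: cg.
by apply: cvgZr; exact: cf.
Qed.

HB.instance Definition _ :=
  GRing.isSubmodClosed.Build R (X -> R^o) dual_pred dual_pred_submod_closed.

(* The topological dual: continuous linear functionals, with the operator norm
   built below; `open` on [dual] refers to the norm topology. *)
Record dual := Dual {
  dual_val :> X -> R^o ;
  dual_valP : dual_val \in dual_pred }.

HB.instance Definition _ := [isSub for dual_val].
HB.instance Definition _ := [Choice of dual by <:].
HB.instance Definition _ := [SubChoice_isSubLmodule of dual by <:].

Lemma dualE0 (x : X) : (0 : dual) x = 0. Proof. by []. Qed.
Lemma dualED (v w : dual) (x : X) : (v + w) x = v x + w x. Proof. by []. Qed.
Lemma dualEN (v : dual) (x : X) : (- v) x = - v x. Proof. by []. Qed.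
Lemma dualEZ (a : R) (v : dual) (x : X) : (a *: v) x = a * v x.
Proof. by []. Qed.

Lemma dual_linear (v : dual) : linear v.
Proof. by case: v => f /= /set_mem[]. Qed.

Lemma dual_continuous (v : dual) : continuous v.
Proof. by case: v => f /= /set_mem[]. Qed.

Definition dual_norm (v : dual) : R :=
  sup [set `|v x| | x in [set x | `|x| <= 1]].

HB.instance Definition _ (v : dual) :=
  GRing.isLinear.Build R X R^o _ v (dual_linear v).

Lemma dual_bounded (v : dual) :
  has_sup [set `|v x| | x in [set x : X | `|x| <= 1]].
Proof.
split; first by exists `|v 0|, 0 => //=; rewrite normr0.
have /linear_bounded_continuous/bounded_funP/(_ 1)[M vM] := @dual_continuous v.
by exists M => _ [x /= x1 <-]; exact: vM.
Qed.

Lemma dual_norm_ub (v : dual) (x : X) : `|v x| <= dual_norm v * `|x|.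
Proof.
have [->|x0] := eqVneq x 0; first by rewrite linear0 !normr0 mulr0.
have nx : 0 < `|x| by rewrite normr_gt0.
rewrite -ler_pdivrMr//.
have -> : `|v x| / `|x| = `|v (`|x|^-1 *: x)|.
  by rewrite linearZ/= normrM normfV normr_id mulrC.
apply: ub_le_sup; first by case: (dual_bounded v).
by exists (`|x|^-1 *: x) => //=; rewrite normrZ normfV normr_id mulVf ?gt_eqF.
Qed.

Lemma dual_norm_le (v : dual) (M : R) :
  (forall x, `|x| <= 1 -> `|v x| <= M) -> dual_norm v <= M.
Proof.
move=> vM; apply: ge_sup; first by case: (dual_bounded v).
by move=> _ [x /= x1 <-]; exact: vM.
Qed.

Lemma dual_norm_ge0 (v : dual) : 0 <= dual_norm v.
Proof.
apply: le_trans (normr_ge0 (v 0)) _; apply: ub_le_sup.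
  by case: (dual_bounded v).
by exists 0 => //=; rewrite normr0.
Qed.

Lemma dual_ler_normD (v w : dual) :
  dual_norm (v + w) <= dual_norm v + dual_norm w.
Proof.
apply: dual_norm_le => x x1; rewrite dualED (le_trans (ler_normD _ _))// lerD//.
  by rewrite (le_trans (dual_norm_ub _ _))// ler_piMr// dual_norm_ge0.
by rewrite (le_trans (dual_norm_ub _ _))// ler_piMr// dual_norm_ge0.
Qed.

Let dual_normZ_le (a : R) (v : dual) :
  dual_norm (a *: v) <= `|a| * dual_norm v.
Proof.
apply: dual_norm_le => x x1; rewrite dualEZ normrM ler_wpM2l//.
by rewrite (le_trans (dual_norm_ub _ _))// ler_piMr// dual_norm_ge0.
Qed.

Lemma dual_normrZ (a : R) (v : dual) :
  dual_norm (a *: v) = `|a| * dual_norm v.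
Proof.
apply/eqP; rewrite eq_le dual_normZ_le/=.
have [->|a0] := eqVneq a 0; first by rewrite normr0 mul0r dual_norm_ge0.
rewrite -ler_pdivlMl ?normr_gt0// -normfV -[in leLHS](scalerK a0 v).
exact: dual_normZ_le.
Qed.

Lemma dual_normr0_eq0 (v : dual) : dual_norm v = 0 -> v = 0.
Proof.
move=> v0; apply/val_inj/funext => x /=; apply/eqP; rewrite -normr_le0.
by rewrite (le_trans (dual_norm_ub v x))// v0 mul0r.
Qed.

HB.instance Definition _ :=
  Lmodule_isNormed.Build R dual dual_ler_normD dual_normrZ dual_normr0_eq0.

(* Topology of pointwise convergence, on the same carrier as [dual]. *)
Definition weak_star : Type :=
  initial_topology (dual_val : dual -> {ptws X -> R^o}).

HB.instance Definition _ := Topological.on weak_star.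

Definition weak_star_compact (A : set dual) : Prop :=
  compact (A : set weak_star).

End Dual.

Section Minkowski.
Context {R : realType} (V : lmodType R).

Definition minkowski_add (A B : set V) : set V := [set a + b | a in A & b in B].

Definition minkowski_scale (c : R) (A : set V) : set V := [set c *: a | a in A].

End Minkowski.

Reserved Notation "\msum_ ( j < n ) A"
  (at level 41, A at level 41, j, n at level 50,
   format "'[' \msum_ ( j  <  n ) '/  '  A ']'").

Declare Scope minkowski_scope.
Delimit Scope minkowski_scope with MK.
Notation "A + B" := (minkowski_add A B) : minkowski_scope.
Notation "c *: A" := (minkowski_scale c A) : minkowski_scope.
Notation "A - B" := (minkowski_add A (minkowski_scale (-1) B)) :
  minkowski_scope.
Notation "\msum_ ( j < n ) A" :=
  (\big[@minkowski_add _ _/[set 0]]_(j < n) A%MK) : minkowski_scope.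

Section Quasidifferential.
Context {R : realType} {X : normedModType R}.

(* A pair [D.1, D.2] of a sub- and a superdifferential. *)
Definition qd : Type := (set (dual X) * set (dual X))%type.

Definition is_max (E : set R) (M : R) : Prop := E M /\ ubound E M.
Definition is_min (E : set R) (m : R) : Prop := E m /\ lbound E m.

Definition has_dir_derivative (f : X -> R) (x h : X) (d : R) : Prop :=
  (f (x + a *: h) - f x) / a @[a --> 0^'+] --> d.

Definition convex_weak_star_compact (A : set (dual X)) : Prop :=
  [/\ A !=set0, convex_set A & weak_star_compact A].

Definition is_quasidifferential (f : X -> R) (x : X) (D : qd) : Prop :=
  [/\ convex_weak_star_compact D.1, convex_weak_star_compact D.2 &
    forall h : X, exists M m : R,
      [/\ is_max [set (v : dual X) h | v in D.1] M,
          is_min [set (w : dual X) h | w in D.2] m &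
          has_dir_derivative f x h (M + m)]].

Definition outer_semicontinuous (U : set X) (D : X -> qd) (x : X) : Prop :=
  forall V1 V2 : set (dual X), open V1 -> open V2 ->
    (D x).1 `<=` V1 -> (D x).2 `<=` V2 ->
    exists2 delta : R, 0 < delta &
      forall x' : X, U x' -> `|x' - x| < delta ->
        (D x').1 `<=` V1 /\ (D x').2 `<=` V2.

Definition qd_plus (D : qd) : set (dual X) := (D.1 + D.2)%MK.

Definition qd_plus_comb (l : nat) (DF : 'I_l -> qd) (y : 'cV[R]_l) :
    set (dual X) :=
  (\msum_(j < l) (y j ord0 *: qd_plus (DF j)))%MK.

(* The library norm on 'cV[R]_l is the max norm. *)
Definition euclidean_norm (l : nat) (y : 'cV[R]_l) : R :=
  Num.sqrt (\sum_(j < l) y j ord0 ^+ 2).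

(* The infima are taken in \bar R, so that inf set0 = +oo. *)
Definition qd_MFCQ (l m : nat) (g : 'I_m -> X -> R) (x : X)
    (DF : 'I_l -> qd) (DG : 'I_m -> qd) : Prop :=
  (0 < ereal_inf
         [set ereal_inf [set `|v|%:E | v in qd_plus_comb DF y]
         | y in [set y : 'cV[R]_l | euclidean_norm y = 1%R]])%E /\
  exists h : X,
    (forall (y : 'cV[R]_l) (v : dual X), qd_plus_comb DF y v -> v h = 0) /\
    (forall i : 'I_m, g i x = 0 ->
       forall v : dual X, qd_plus (DG i) v -> v h < 0).

Definition lipschitz_near (f : X -> R) (x : X) : Prop :=
  exists2 U : set X, nbhs x U & [lipschitz f y | y in U].

Definition feasible (l m : nat) (f : 'I_l -> X -> R) (g : 'I_m -> X -> R)
    (x : X) : Prop :=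
  (forall j, f j x = 0) /\ (forall i, g i x <= 0).

Definition locally_optimal (l m : nat) (u : X -> R) (f : 'I_l -> X -> R)
    (g : 'I_m -> X -> R) (x : X) : Prop :=
  feasible f g x /\
  \forall y \near x, feasible f g y -> u x <= u y.

Definition penalty (l m : nat) (u : X -> R) (f : 'I_l -> X -> R)
    (g : 'I_m -> X -> R) (c : R) (x : X) : R :=
  u x + c * (\sum_(j < l) `|f j x| + \sum_(i < m) Num.max (g i x) 0).

End Quasidifferential.

Arguments qd {R} X.

(* Main.v *)
Require Import Defs.
From HB Require Import structures.
From mathcomp Require Import all_boot all_order all_algebra.
From mathcomp Require Import all_classical all_reals all_analysis.
From mathcomp Require Import ring lra.

Set Implicit Arguments.
Unset Strict Implicit.
Unset Printing Implicit Defensive.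

Import Order.TTheory GRing.Theory Num.Theory.
Import numFieldNormedType.Exports.

Local Open Scope classical_set_scope.
Local Open Scope ring_scope.

(** The constraint qualification makes an exact penalty function out of
[penalty], and the multipliers are then read off from the fact that [xbar] is an
unconstrained local minimiser of that function.

Error bound.  Measure infeasibility by [residual f g], the Euclidean norm of
[f] plus the sum of the positive parts of the [g i].  The first half of the
constraint qualification says that for a unit vector [y] the weak-star compact
convex set [qd_plus_comb DF y] keeps a positive distance [kappa] from 0, so a
minimax argument ([uniform_descent]) yields one direction of norm at most 1 on
which all its elements are below [- kappa].  Taking for [y] the normalised value
of [f], such a direction decreases the norm of [f]; adding a large multiple of
the vector [hbar] of the second half does not disturb [f] to first order and
makes the active [g i] decrease.  When [f] vanishes, [hbar] alone does the job.
Outer semicontinuity transports these estimates, made at [xbar], to nearby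
points with an arbitrarily small loss ([osc_dir_derivative]).  Hence at every
infeasible point near [xbar] the residual has a direction of decrease whose
slope is bounded away from 0 ([mfcq_descent]).  In a complete space such a
uniform decrease forces a zero of the residual within a distance proportional
to its value ([descent_to_zero], an Ekeland-type argument), that is, the
distance to the feasible set is at most [K] times the residual ([error_bound]).
This needs the constraints to be continuous near [xbar], which is not assumed:
it follows because weak-star compact sets are norm bounded, so the directional
derivatives are bounded near [xbar] and the functions are Lipschitz there.

Exact penalty.  If [L] is a Lipschitz constant of [u], moving from [x] to the
feasible point given by the error bound changes [u] by at most
[L * K * residual f g x], so [xbar] minimises [penalty u f g c] locally for all [c >= L * K]
([exact_penalty]).

Multipliers.  At a local minimiser the directional derivative is nonnegative in
every direction.  For a quasidifferential this says that for each [w] in the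
superdifferential the set obtained by translating the subdifferential by [w]
has a nonnegative support function, hence contains 0 ([zero_in_cwc],
[qd_minimum]).  Computing the derivative of the penalty function directly and
bounding each term by fixing the selections [w0], [v j], [w j], [z i], the same
argument puts 0 in a Minkowski sum of [c] times convex hulls of two sets
([penalty_multipliers]); the coefficients of these convex combinations,
multiplied by [c], are the multipliers, which is why they are bounded by
[c] whatever the selections are. *)

(** * Weak-star topology *)

Section WeakStarTopology.
Context {R : realType} {X : normedModType R}.
Implicit Types (v w : dual X) (A B S : set (dual X)) (h : X).

Lemma weak_star_eval_continuous h :
  continuous (fun v : weak_star X => (v : dual X) h).
Proof.
move=> v.
have c1 : {for v, continuous ((@dual_val R X) : weak_star X -> {ptws X -> R^o})}.
  exact: (@initial_continuous (dual X) {ptws X -> R^o} (@dual_val R X)).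
have c2 : {for @dual_val R X v, continuous (fun f : {ptws X -> R^o} => f h)}.
  exact: (@proj_continuous X (fun=> R^o) h).
exact: (@continuous_comp (weak_star X) {ptws X -> R^o} R^o _ _ v c1 c2).
Qed.

(** Continuity into the weak-star topology can be tested by evaluations; this is
how every compactness proof below avoids the topology of the dual. *)
Lemma weak_star_continuous (T : topologicalType) (F : T -> dual X) :
  (forall h, continuous (fun t => F t h)) ->
  continuous (F : T -> weak_star X).
Proof.
move=> cF; apply/continuousP => _ [B Bop <-].
have cF' : continuous ((@dual_val R X \o F) : T -> {ptws X -> R^o}).
  by move=> t; apply/pointwise_cvgP => h; exact: cF.
by move/continuousP : cF'; exact.
Qed.

Lemma weak_star_compact_image (T : topologicalType) (K : set T)
    (F : T -> dual X) :
  compact K -> (forall h, continuous (fun t => F t h)) ->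
  weak_star_compact (F @` K).
Proof.
move=> cK cF; apply: (@continuous_compact T (weak_star X)) => //.
apply: continuous_subspaceT; exact: weak_star_continuous.
Qed.

Lemma dual_convexP A :
  convex_set A <-> (forall v w (t : R), A v -> A w -> 0 <= t <= 1 ->
    A (t *: v + (1 - t) *: w)).
Proof.
split=> [cA v w t Av Aw t01|cA v w t]; last first.
  rewrite !inE => Av Aw.
  by apply: (cA v w t%:num) => //; rewrite ge0/= le1.
have := cA v w (Itv01 (proj1 (andP t01)) (proj2 (andP t01))).
by rewrite !inE; apply.
Qed.

(** [cwc] abbreviates [convex_weak_star_compact].  The convexity clause is put in
terms of real scalars, which can be computed with, instead of the abstract
convex combinations of [convex_set]. *)
Lemma cwcP A : convex_weak_star_compact A <->
  [/\ A !=set0, (forall v w (t : R), A v -> A w -> 0 <= t <= 1 ->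
    A (t *: v + (1 - t) *: w)) & weak_star_compact A].
Proof. by split=> -[A0 /dual_convexP cA wA]; split=> //; apply/dual_convexP. Qed.

Lemma cwc_min S (f : dual X -> R) : convex_weak_star_compact S ->
  continuous (f : weak_star X -> R) ->
  exists2 v, S v & forall w, S w -> f v <= f w.
Proof.
move=> [S0 _ cS] cf.
have [|v vS fv] := @compact_EVT_min (weak_star X) R f S S0 cS.
  exact: continuous_subspaceT.
exists v; first by move: vS; rewrite inE.
by move=> w Sw; apply: fv; rewrite inE.
Qed.

End WeakStarTopology.

(** * A minimax theorem for weak-star compact convex sets *)

Lemma cvg_sqr {R : realType} {T : Type} {F : set_system T} {FF : Filter F}
    (p : T -> R) (x : R) :
  p t @[t --> F] --> x -> p t ^+ 2 @[t --> F] --> x ^+ 2.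
Proof. by move=> px; under eq_fun do rewrite expr2; rewrite expr2; exact: cvgM. Qed.

Lemma cvg_maxr0 {R : realType} {T : Type} {F : set_system T} {FF : Filter F}
    (p : T -> R) (x : R) :
  p t @[t --> F] --> x -> Num.max (p t) 0 @[t --> F] --> Num.max x 0.
Proof.
have maxE (y : R) : Num.max y 0 = (y + `|y|) / 2.
  by case: (leP y 0) => y0; [rewrite ler0_norm//|rewrite gtr0_norm//]; lra.
move=> px; rewrite maxE; under eq_fun do rewrite maxE.
by apply: cvgMr_tmp; apply: cvgD => //; exact: cvg_norm.
Qed.

Section Minimax.
Context {R : realType} {X : normedModType R}.
Implicit Types (v w : dual X) (S : set (dual X)) (h : X).

Definition convex_in (C : set X) := forall h1 h2 (t : R),
  C h1 -> C h2 -> 0 <= t <= 1 -> C (t *: h1 + (1 - t) *: h2).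

Lemma dual_comb v h1 h2 (a b : R) :
  v (a *: h1 + b *: h2) = a * v h1 + b * v h2.
Proof. by rewrite linearD !linearZ. Qed.

Let pos (x : R) : R := Num.max x 0.

Let pos_sq_le (a d t : R) : pos (a - t * d) ^+ 2 <= (pos a - t * d) ^+ 2.
Proof. by rewrite /pos; case: (leP (a - t * d) 0) => ?; case: (leP a 0) => ?; nra. Qed.

(** The first order condition at [t = 0] for a quadratic function of [t], obtained
by evaluating at one sufficiently small [t]. *)
Let pos_sq_slope (p d q e : R) :
  (forall t, 0 < t <= 1 ->
     p ^+ 2 + q ^+ 2 <= (p - t * d) ^+ 2 + (q - t * e) ^+ 2) ->
  p * d + q * e <= 0.
Proof.
move=> H; rewrite leNgt; apply/negP => pos0.
set s := p * d + q * e in pos0; set n := d ^+ 2 + e ^+ 2.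
have n0 : 0 <= n by rewrite addr_ge0 ?sqr_ge0.
(* If the sum [s] were positive, this [t] would be in [0, 1] and satisfy
   [t * n < 2 * s], so the quadratic function would decrease. *)
pose t := s / (s + n + 1).
have D0 : 0 < s + n + 1 by lra.
have t01 : 0 < t <= 1 by rewrite divr_gt0//= ler_pdivrMr// mul1r; lra.
have := H _ t01; have tD : t * (s + n + 1) = s by rewrite /t divfK// gt_eqF.
case/andP: t01 => t0 _; rewrite /s /n in tD pos0 n0 D0 *; nra.
Qed.

(** Minimise over [S] the sum of the squared amounts by which [v h1] and [v h2]
fall short of [k].  If the minimum is positive, the two shortfalls at a minimiser,
normalised, are the weights of a point of the segment from [h2] to [h1] where
all of [S] stays below [k]: this is the first order condition at the
minimiser. *)
Lemma minimax_two S (k : R) h1 h2 : convex_weak_star_compact S ->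
  (forall t : R, 0 <= t <= 1 ->
     exists2 v, S v & k <= v (t *: h1 + (1 - t) *: h2)) ->
  exists v, [/\ S v, k <= v h1 & k <= v h2].
Proof.
move=> cS H.
pose F v := pos (k - v h1) ^+ 2 + pos (k - v h2) ^+ 2.
have posC h : continuous (fun v : weak_star X => pos (k - (v : dual X) h)).
  move=> v; exact: (cvg_maxr0 (cvgB (cvg_cst k)
    (@weak_star_eval_continuous R X h v))).
have [v0 Sv0 v0min] : exists2 v, S v & forall w, S w -> F v <= F w.
  apply: cwc_min => // v.
  exact: (cvgD (cvg_sqr (posC h1 v)) (cvg_sqr (posC h2 v))).
set p := pos (k - v0 h1) in v0min *; set q := pos (k - v0 h2) in v0min *.
have p0 : 0 <= p by rewrite /p /pos le_max lexx orbT.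
have q0 : 0 <= q by rewrite /q /pos le_max lexx orbT.
have [pq0|pq0] := leP (p + q) 0.
  exists v0; split=> //.
    have : k - v0 h1 <= p by rewrite /p /pos le_max lexx.
    by lra.
  have : k - v0 h2 <= q by rewrite /q /pos le_max lexx.
  by lra.
have slope v : S v -> p * (v h1 - v0 h1) + q * (v h2 - v0 h2) <= 0.
  move=> Sv; apply: pos_sq_slope => t /andP[t0 t1].
  have St : S (t *: v + (1 - t) *: v0).
    by have /cwcP[_ cv _] := cS; apply: cv => //; rewrite ltW.
  apply: le_trans (v0min _ St) _; rewrite /F !dualED !dualEZ.
  have -> : k - (t * v h1 + (1 - t) * v0 h1) =
    (k - v0 h1) - t * (v h1 - v0 h1) by ring.
  have -> : k - (t * v h2 + (1 - t) * v0 h2) =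
    (k - v0 h2) - t * (v h2 - v0 h2) by ring.
  by rewrite lerD// pos_sq_le.
have [|v Sv] := H (p / (p + q)).
  apply/andP; split; first by rewrite divr_ge0// ltW.
  by rewrite ler_pdivrMr// mul1r; lra.
have E : 1 - p / (p + q) = q / (p + q) by field; rewrite gt_eqF.
rewrite E dual_comb.
have -> : p / (p + q) * v h1 + q / (p + q) * v h2 =
  (p * v h1 + q * v h2) / (p + q) by field; rewrite gt_eqF.
rewrite ler_pdivlMr// => kv; exfalso.
have := slope _ Sv.
have pv : p * (k - v0 h1) = p ^+ 2.
  by rewrite /p /pos; case: (leP (k - v0 h1) 0) => _; rewrite ?mul0r ?expr0n ?expr2.
have qv : q * (k - v0 h2) = q ^+ 2.
  by rewrite /q /pos; case: (leP (k - v0 h2) 0) => _; rewrite ?mul0r ?expr0n ?expr2.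
have pq : 0 < p ^+ 2 + q ^+ 2.
  have [p1|p1] := ltP 0 p; first by rewrite ltr_wpDr ?sqr_ge0// exprn_gt0.
  by rewrite ltr_wpDl ?sqr_ge0// exprn_gt0//; lra.
clearbody p q; move: kv pv qv; rewrite !mulrBr mulrDr; lra.
Qed.

Lemma weak_star_closed_ge (k : R) h :
  closed ([set v : dual X | k <= v h] : set (weak_star X)).
Proof.
apply: (@closed_comp _ _ (fun v : weak_star X => (v : dual X) h : R)
  [set x | k <= x]); last exact: closed_ge.
by move=> ? _; exact: weak_star_eval_continuous.
Qed.

Lemma cwc_halfspace S (k : R) h : convex_weak_star_compact S ->
  (exists2 v, S v & k <= v h) ->
  convex_weak_star_compact (S `&` [set v | k <= v h]).
Proof.
move=> /cwcP[S0 cS kS] [v Sv kv]; apply/cwcP; split.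
- by exists v.
- move=> a b t [Sa /= ka] [Sb /= kb] t01; split; first exact: cS.
  suff : k <= (t *: a + (1 - t) *: b) h by [].
  by rewrite dualED !dualEZ; case/andP: t01 => ? ?; nra.
- exact: (@compact_closedI (weak_star X) _ _ kS (@weak_star_closed_ge k h)).
Qed.

(** A minimax theorem that needs neither the Hahn-Banach theorem nor compactness
of the dual ball.  Intersecting [S] with a half-space keeps the hypothesis, by
[minimax_two]; by induction all finite intersections are nonempty, and weak-star
compactness gives a common point. *)
Lemma minimax S (C : set X) (k : R) : convex_weak_star_compact S ->
  convex_in C ->
  (forall h, C h -> exists2 v, S v & k <= v h) ->
  exists2 v, S v & forall h, C h -> k <= v h.
Proof.
move=> cS cC H.
pose Sf (s : seq X) := [set v | S v /\ forall h, h \in s -> k <= v h].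
have fin (s : seq X) : (forall h, h \in s -> C h) ->
    convex_weak_star_compact (Sf s) /\
    (forall h, C h -> exists2 v, Sf s v & k <= v h).
  elim: s => [_|h0 s IH sC].
    have -> : Sf [::] = S by apply/seteqP; split=> v //= [].
    by [].
  have [|cSf Hs] := IH; first by move=> h hs; apply: sC; rewrite inE hs orbT.
  have Ch0 : C h0 by apply: sC; rewrite inE eqxx.
  have -> : Sf (h0 :: s) = Sf s `&` [set v | k <= v h0].
    apply/seteqP; split=> v /=.
      move=> [Sv kv]; split; last by apply: kv; rewrite inE eqxx.
      by split=> // h hs; apply: kv; rewrite inE hs orbT.
    move=> [[Sv kv] kv0]; split=> // h; rewrite inE => /orP[/eqP->//|].
    exact: kv.
  split; first by apply: cwc_halfspace => //; exact: Hs.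
  move=> h Ch.
  have [|v [Sv kv0 kv]] := @minimax_two _ k h0 h cSf.
    by move=> t t01; apply: Hs; exact: cC.
  by exists v.
pose F := filter_from [set s : seq X | forall h, h \in s -> C h] Sf.
have FF : ProperFilter F.
  apply: filter_from_proper; last first.
    by move=> s /fin[[]].
  apply: filter_from_filter; first by exists [::].
  move=> s t sC tC; exists (s ++ t) => /=.
    by move=> h; rewrite mem_cat => /orP[/sC|/tC].
  by move=> v [Sv kv]; split; split=> // h hs; apply: kv; rewrite mem_cat hs ?orbT.
(* The sets [Sf s] form a filter base, and any cluster point of this filter
   satisfies all the inequalities. *)
have [_ _ kS] := cS.
have [|v [Sv clv]] := kS F FF.
  by exists [::] => // v [].
exists v => // h Ch.
apply: (@weak_star_closed_ge k h) => B Bv; apply: clv Bv; exists [:: h] => /=.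
  by move=> h'; rewrite inE => /eqP->.
by move=> w [_]; apply; rewrite inE.
Qed.

(** Minimax on the whole space with [k = 0]: a functional that is nonnegative
everywhere is 0. *)
Lemma zero_in_cwc S : convex_weak_star_compact S ->
  (forall h, exists2 v, S v & 0 <= v h) -> S 0.
Proof.
move=> cS H.
have [|h _|v Sv v0] := @minimax S setT 0 cS; [by []|exact: H|].
suff -> : 0 = v by [].
apply/val_inj/funext => h /=; apply/eqP; rewrite eq_le v0//=.
by have := v0 (- h) I; rewrite linearN oppr_ge0.
Qed.

(** Minimax on the unit ball with threshold [- k]: the only alternative is a
functional in [S] that is at least [- k] on the ball, so has norm at most [k]. *)
Lemma uniform_descent S (k : R) : convex_weak_star_compact S -> 0 <= k ->
  (forall v, S v -> k < `|v|) ->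
  exists2 h, `|h| <= 1 & forall v, S v -> v h < - k.
Proof.
move=> cS k0 H; apply: contrapT => N.
have [||v Sv vk] := @minimax S [set h | `|h| <= 1] (- k) cS.
- move=> h1 h2 t /= h11 h21 /andP[t0 t1].
  rewrite (le_trans (ler_normD _ _))// !normrZ !ger0_norm ?subr_ge0//.
  by have := normr_ge0 h1; have := normr_ge0 h2; nra.
- move=> h h1; apply: contrapT => N'; apply: N; exists h => // v Sv.
  by rewrite ltNge; apply/negP => kv; apply: N'; exists v.
have := H _ Sv; apply/negP; rewrite -leNgt; apply: dual_norm_le => h h1.
rewrite ler_norml; apply/andP; split; first exact: vk.
by have := vk (- h); rewrite /= normrN linearN lerN2; exact.
Qed.

End Minimax.

(** * Operations on weak-star compact convex sets *)

Section MinkowskiSums.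
Context {R : realType} {V : lmodType R}.

Lemma msumP n (A : 'I_n -> set V) (x : V) :
  (\msum_(j < n) A j)%MK x <->
  exists2 a : 'I_n -> V, (forall j, A j (a j)) & x = \sum_(j < n) a j.
Proof.
elim: n A x => [|n IH] A x.
  rewrite big_ord0; split=> [->|[a _ ->]]; last by rewrite big_ord0.
  by exists (fun=> 0); [case|rewrite big_ord0].
rewrite big_ord_recl; split=> [[a0 A0 [s /IH[a Aa ->] <-]]|[a Aa ->]].
  exists (fun j => oapp a a0 (unlift ord0 j)).
    by move=> j; case: unliftP => [k ->|->]//=.
  by rewrite big_ord_recl unlift_none/=; congr (_ + _); apply: eq_bigr => k _;
    rewrite liftK.
rewrite big_ord_recl; exists (a ord0) => //; exists (\sum_(i < n) a (lift ord0 i)) => //.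
by apply/IH; exists (fun i => a (lift ord0 i)).
Qed.

End MinkowskiSums.

Section Closure.
Context {R : realType} {X : normedModType R}.
Implicit Types (v w : dual X) (A B S : set (dual X)) (h : X).

Lemma dual_sumE n (a : 'I_n -> dual X) h :
  (\sum_(j < n) a j) h = \sum_(j < n) a j h.
Proof.
elim: n a => [|n IH] a; first by rewrite !big_ord0.
by rewrite !big_ord_recl dualED IH.
Qed.

Lemma cwc_set1 v : convex_weak_star_compact [set v].
Proof.
apply/cwcP; split; first by exists v.
  by move=> _ _ t -> -> _ /=; rewrite -scalerDl subrKC scale1r.
exact: (@compact_set1 (weak_star X) v).
Qed.

Lemma cwc_add A B : convex_weak_star_compact A -> convex_weak_star_compact B ->
  convex_weak_star_compact (A + B)%MK.
Proof.
move=> /cwcP[[a0 Aa0] cA kA] /cwcP[[b0 Bb0] cB kB]; apply/cwcP; split.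
- by exists (a0 + b0); exists a0 => //; exists b0.
- move=> _ _ t [a Aa [b Bb <-]] [a' Aa' [b' Bb' <-]] t01.
  exists (t *: a + (1 - t) *: a'); first exact: cA.
  exists (t *: b + (1 - t) *: b'); first exact: cB.
  by rewrite !scalerDr addrACA.
- have -> : (A + B)%MK =
      (fun p : weak_star X * weak_star X => (p.1 : dual X) + (p.2 : dual X)) @`
        (A `*` B).
    apply/seteqP; split=> [_ [a Aa [b Bb <-]]|_ [[a b] [/= Aa Bb] <-]].
      by exists (a, b).
    by exists a => //; exists b.
  apply: (@weak_star_compact_image _ _ (weak_star X * weak_star X)%type
    (A `*` B)).
    exact: (@compact_setX (weak_star X) (weak_star X) A B kA kB).
  move=> h p.
  apply: (@cvgD _ _ _ _ _ (fun p : weak_star X * weak_star X => (p.1 : dual X) h : R)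
     (fun p : weak_star X * weak_star X => (p.2 : dual X) h : R)).
    apply: (@cvg_comp _ _ _ fst (fun v : weak_star X => (v : dual X) h) _
      (nbhs (p.1 : weak_star X))); first exact: cvg_fst.
    exact: weak_star_eval_continuous.
  apply: (@cvg_comp _ _ _ snd (fun v : weak_star X => (v : dual X) h) _
    (nbhs (p.2 : weak_star X))); first exact: cvg_snd.
  exact: weak_star_eval_continuous.
Qed.

Lemma cwc_scale c A : convex_weak_star_compact A ->
  convex_weak_star_compact (c *: A)%MK.
Proof.
move=> /cwcP[[a0 Aa0] cA kA]; apply/cwcP; split.
- by exists (c *: a0); exists a0.
- move=> _ _ t [a Aa <-] [a' Aa' <-] t01.
  exists (t *: a + (1 - t) *: a'); first exact: cA.
  by rewrite scalerDr !scalerA ![c * _]mulrC.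
- apply: (@weak_star_compact_image _ _ (weak_star X) A (fun v => c *: (v : dual X))) => //.
  move=> h p.
  exact: (cvgM (cvg_cst c) (@weak_star_eval_continuous R X h p)).
Qed.

Lemma cwc_msum n (A : 'I_n -> set (dual X)) :
  (forall j, convex_weak_star_compact (A j)) ->
  convex_weak_star_compact (\msum_(j < n) A j)%MK.
Proof.
elim: n A => [|n IH] A cA; first by rewrite big_ord0; exact: cwc_set1.
by rewrite big_ord_recl; apply: cwc_add => //; exact: IH.
Qed.

(** For convex [A] and [B] this is the convex hull of their union.  It plays the
role of a subdifferential of the maximum of two support functions. *)
Definition segment_hull A B : set (dual X) :=
  [set v | exists (t : R) (a b : dual X),
     [/\ 0 <= t <= 1, A a, B b & v = t *: a + (1 - t) *: b]].

Let weighted (t1 t2 : R) v w : 0 <= t1 -> 0 <= t2 -> 0 < t1 + t2 ->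
  exists2 t : R, 0 <= t <= 1 &
    (t1 + t2) *: (t *: v + (1 - t) *: w) = t1 *: v + t2 *: w.
Proof.
move=> t10 t20 t0; exists (t1 / (t1 + t2)).
  apply/andP; split; first by rewrite divr_ge0// ltW.
  by rewrite ler_pdivrMr// mul1r; lra.
have tn0 : t1 + t2 != 0 by rewrite gt_eqF.
rewrite scalerDr !scalerA [_ * (t1 / _)]mulrC divfK//.
suff -> : (t1 + t2) * (1 - t1 / (t1 + t2)) = t2 by [].
by field.
Qed.

(** Clearing the denominator of the normalised weights covers the case where both
weights vanish, which does occur in [cwc_segment_hull]. *)
Let convex_mix A (t1 t2 : R) v w : (forall v w (t : R), A v -> A w ->
    0 <= t <= 1 -> A (t *: v + (1 - t) *: w)) ->
  A v -> A w -> 0 <= t1 -> 0 <= t2 ->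
  exists2 u, A u & (t1 + t2) *: u = t1 *: v + t2 *: w.
Proof.
move=> cA Av Aw t10 t20; have [t0|t0] := ltP 0 (t1 + t2).
  have [t t01 E] := weighted v w t10 t20 t0.
  by exists (t *: v + (1 - t) *: w) => //; exact: cA.
have -> : t1 = 0 by lra.
have -> : t2 = 0 by lra.
by exists v; rewrite // addr0 !scale0r addr0.
Qed.

Lemma cwc_segment_hull A B :
  convex_weak_star_compact A -> convex_weak_star_compact B ->
  convex_weak_star_compact (segment_hull A B).
Proof.
move=> /cwcP[[a0 Aa0] cA kA] /cwcP[[b0 Bb0] cB kB]; apply/cwcP; split.
- exists (1 *: a0 + (1 - 1) *: b0); exists 1, a0, b0; split=> //.
  by rewrite ler01 lexx.
- move=> _ _ s [t [a [b [t01 Aa Bb ->]]]] [t' [a' [b' [t01' Aa' Bb' ->]]]] s01.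
  have [[t0 t1] [t0' t1'] [s0 s1]] := And3 (andP t01) (andP t01') (andP s01).
  have [r0 r0' q0] : [/\ 0 <= 1 - t, 0 <= 1 - t' & 0 <= 1 - s].
    by rewrite !subr_ge0.
  have [||a1 Aa1 E1] := convex_mix (t1 := s * t) (t2 := (1 - s) * t') cA Aa Aa'.
  + exact: mulr_ge0.
  + exact: mulr_ge0.
  have [||b1 Bb1 E2] := convex_mix (t1 := s * (1 - t)) (t2 := (1 - s) * (1 - t')) cB Bb Bb'.
  + exact: mulr_ge0.
  + exact: mulr_ge0.
  exists (s * t + (1 - s) * t'), a1, b1; split=> //.
    rewrite addr_ge0 ?mulr_ge0//=.
    have := ler_wpM2l s0 t1; have := ler_wpM2l q0 t1'; rewrite !mulr1; lra.
  have -> : 1 - (s * t + (1 - s) * t') = s * (1 - t) + (1 - s) * (1 - t') by ring.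
  by rewrite E1 E2 !scalerDr !scalerA addrACA.
- pose T := (R^o * (weak_star X * weak_star X))%type.
  pose F := fun p : T => p.1 *: (p.2.1 : dual X) + (1 - p.1) *: (p.2.2 : dual X).
  have -> : segment_hull A B = F @` (`[0, 1] `*` (A `*` B)).
    apply/seteqP; split=> [_ [t [a [b [t01 Aa Bb ->]]]]|].
      by exists (t, (a, b)) => //; split=> //=; rewrite in_itv.
    move=> _ [[t [a b]] [/= t01 [/= Aa Bb]] <-]; exists t, a, b; split=> //.
  apply: (@weak_star_compact_image _ _ T).
    apply: (@compact_setX R^o (weak_star X * weak_star X)%type).
      exact: segment_compact.
    exact: (@compact_setX (weak_star X) (weak_star X) A B kA kB).
  move=> h p.
  have c1 : ((q : T).1 : R) @[q --> p] --> (p.1 : R) by exact: cvg_fst.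
  have c2 : (((q : T).2.1 : dual X) h : R) @[q --> p] --> ((p.2.1 : dual X) h : R).
    apply: (@cvg_comp _ _ _ (fun q : T => q.2.1) (fun v : weak_star X => (v : dual X) h) _
      (nbhs (p.2.1 : weak_star X))).
      by apply: (@cvg_comp _ _ _ snd fst _ (nbhs p.2)); [exact: cvg_snd|exact: cvg_fst].
    exact: weak_star_eval_continuous.
  have c3 : (((q : T).2.2 : dual X) h : R) @[q --> p] --> ((p.2.2 : dual X) h : R).
    apply: (@cvg_comp _ _ _ (fun q : T => q.2.2) (fun v : weak_star X => (v : dual X) h) _
      (nbhs (p.2.2 : weak_star X))).
      by apply: (@cvg_comp _ _ _ snd snd _ (nbhs p.2)); [exact: cvg_snd|exact: cvg_snd].
    exact: weak_star_eval_continuous.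
  have := cvgD (cvgM c1 c2) (cvgM (cvgB (cvg_cst (1 : R)) c1) c3).
  by apply; exact: (@nbhs_filter T p).
Qed.

End Closure.

(** Evaluations are bounded on [S] by compactness; completeness of [X] enters
through the uniform boundedness principle. *)
Lemma weak_star_compact_bounded (R : realType) (X : completeNormedModType R)
    (S : set (dual X)) :
  weak_star_compact S -> exists2 M : R, 0 <= M & forall v, S v -> `|v| <= M.
Proof.
move=> kS.
pose F : set (X -> R^o) := [set dual_val v | v in S].
have [f [v Sv <-]| x |M HM] := @Banach_Steinhauss R X R^o F _ _ 1.
- split; last exact: dual_linear.
  by move=> r; exists (dual_norm v * r) => x xr;
    rewrite (le_trans (dual_norm_ub v x))// ler_wpM2l// dual_norm_ge0.
- pose e := fun v : weak_star X => (v : dual X) x : R^o.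
  have /compact_bounded[M [_ HM]] : compact (e @` S).
    apply: (@continuous_compact (weak_star X)) => //.
    apply: (@continuous_subspaceT (weak_star X)) => w.
    exact: (@weak_star_eval_continuous R X x w).
  exists (M + 1) => _ [v Sv <-]; apply: (HM (M + 1)); first by rewrite ltrDl.
  by exists v.
exists (Num.max M 0); first by rewrite le_max lexx orbT.
move=> v Sv; apply: dual_norm_le => x x1; rewrite le_max; apply/orP; left.
by apply: HM => //; exists v.
Qed.

(** * Directional derivatives *)

Lemma near_cvg {R : realType} {T : Type} {F : set_system T} {FF : Filter F}
    (p q : T -> R) (l : R) :
  (\forall t \near F, p t = q t) ->
  p t @[t --> F] --> l -> q t @[t --> F] --> l.
Proof. by move=> pq pl; apply: cvg_trans pl; exact: near_eq_cvg. Qed.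

Section DirectionalDerivative.
Context {R : realType} {X : normedModType R}.
Implicit Types (f : X -> R) (x h : X) (d : R).

Lemma dir_derivative_near f x h d k : has_dir_derivative f x h d -> d < k ->
  \forall a \near 0^'+, f (x + a *: h) - f x <= k * a.
Proof.
move=> fd dk; near=> a.
have a0 : 0 < a by near: a; exact: nbhs_right_gt.
rewrite -ler_pdivrMr// ltW//; near: a; exact: (cvgr_lt d).
Unshelve. all: by end_near. Qed.

Lemma dir_derivativeN f x h d : has_dir_derivative f x h d ->
  has_dir_derivative (fun y => - f y) x h (- d).
Proof.
move=> fd; rewrite /has_dir_derivative.
by under eq_fun do rewrite -opprD mulNr; exact: cvgN.
Qed.

Lemma dir_derivativeD f g x h d e : has_dir_derivative f x h d ->
  has_dir_derivative g x h e ->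
  has_dir_derivative (fun y => f y + g y) x h (d + e).
Proof.
move=> fd ge; rewrite /has_dir_derivative.
under eq_fun do rewrite opprD addrACA mulrDl.
exact: cvgD.
Qed.

Lemma dir_derivativeZ c f x h d : has_dir_derivative f x h d ->
  has_dir_derivative (fun y => c * f y) x h (c * d).
Proof.
move=> fd; rewrite /has_dir_derivative.
under eq_fun do rewrite -mulrBr -mulrA.
exact: (cvgM (cvg_cst c)).
Qed.

Lemma dir_derivative_sum n (f : 'I_n -> X -> R) x h (d : 'I_n -> R) :
  (forall j, has_dir_derivative (f j) x h (d j)) ->
  has_dir_derivative (fun y => \sum_(j < n) f j y) x h (\sum_(j < n) d j).
Proof.
elim: n f d => [|n IH] f d fd.
  rewrite /has_dir_derivative; under eq_fun do rewrite !big_ord0 subrr mul0r.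
  by rewrite big_ord0; exact: cvg_cst.
rewrite big_ord_recl; under eq_fun do rewrite big_ord_recl.
exact: (dir_derivativeD (fd ord0) (IH _ _ (fun j => fd (lift ord0 j)))).
Qed.

Lemma dir_derivative_cvg f x h d : has_dir_derivative f x h d ->
  f (x + a *: h) @[a --> 0^'+] --> f x.
Proof.
move=> fd.
have id0 : (a : R) @[a --> 0^'+] --> (0 : R) by exact: cvg_at_right_filter.
have lim : (f (x + a *: h) - f x) / a * a + f x @[a --> 0^'+] --> d * 0 + f x.
  by apply: cvgD; [exact: cvgM|exact: cvg_cst].
rewrite mulr0 add0r in lim; refine (near_cvg _ lim); near=> a.
by rewrite divfK ?subrK// gt_eqF.
Unshelve. all: by end_near. Qed.

Lemma dir_derivative_near_eq f g x h d : f x = g x ->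
  (\forall a \near 0^'+, f (x + a *: h) = g (x + a *: h)) ->
  has_dir_derivative f x h d -> has_dir_derivative g x h d.
Proof.
move=> fgx fg fd; refine (near_cvg _ fd).
by apply: filterS fg => a ->; rewrite fgx.
Qed.

(** Where [f x < 0] the positive part vanishes along the ray, where [f x > 0] it
coincides with [f]; only at a zero of [f] does the kink matter. *)
Lemma dir_derivative_pos_part f x h d : has_dir_derivative f x h d ->
  has_dir_derivative (fun y => Num.max (f y) 0) x h
    (if f x < 0 then 0 else if f x == 0 then Num.max d 0 else d).
Proof.
move=> fd; have fc := dir_derivative_cvg fd.
case: ltP => [fx0|].
  apply: (@dir_derivative_near_eq (fun=> 0)).
  - by rewrite max_r// ltW.
  - near=> a; rewrite max_r// ltW//; near: a; exact: (cvgr_lt (f x)).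
  - by rewrite /has_dir_derivative; under eq_fun do rewrite subrr mul0r;
      exact: cvg_cst.
rewrite le_eqVlt => /orP[/eqP fx0|fx0]; rewrite eq_sym.
  rewrite -fx0 eqxx /has_dir_derivative -fx0 maxxx.
  have lim : Num.max ((f (x + a *: h) - f x) / a) 0 @[a --> 0^'+] -->
    Num.max d 0 by exact: cvg_maxr0.
  refine (near_cvg _ lim); near=> a.
  have a0 : 0 < a by [].
  by rewrite -fx0 !subr0 maxr_pMl ?invr_ge0 ?ltW// mul0r.
rewrite lt_eqF//; apply: (@dir_derivative_near_eq f) => //.
- by rewrite max_l// ltW.
- near=> a; rewrite max_l// ltW//; near: a; exact: (cvgr_gt (f x)).
Unshelve. all: by end_near. Qed.

Lemma dir_derivative_norm0 f x h d : f x = 0 -> has_dir_derivative f x h d ->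
  has_dir_derivative (fun y => `|f y|) x h `|d|.
Proof.
move=> fx0 fd; rewrite /has_dir_derivative fx0 normr0.
have lim : `|(f (x + a *: h) - f x) / a| @[a --> 0^'+] --> `|d|.
  by exact: cvg_norm.
 refine (near_cvg _ lim); near=> a.
have a0 : 0 < a by [].
by rewrite fx0 !subr0 normrM normfV (gtr0_norm a0).
Unshelve. all: by end_near. Qed.

Lemma dir_derivative_ge0 f x h d : has_dir_derivative f x h d ->
  (\forall y \near x, f x <= f y) -> 0 <= d.
Proof.
move=> fd fmin; have : \forall a \near 0^'+, 0 <= (f (x + a *: h) - f x) / a.
  have c0 : x + a *: h @[a --> (0 : R)^'+] --> x.
    rewrite -[X in _ --> X]addr0 -(scale0r h).
    apply: cvgD; first exact: cvg_cst.
    by apply: cvgZr_tmp; exact: cvg_at_right_filter.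
  near=> a; rewrite divr_ge0 ?subr_ge0//; first by near: a; exact: c0 fmin.
by move=> /(limr_ge (cvgP _ fd)); rewrite (cvg_lim _ fd).
Unshelve. all: by end_near. Qed.

(** A mean value inequality without differentiability.  Fix a slope [K] slightly
larger than [M] and let [tau] be the last parameter up to which the increment
has slope at most [K].  The derivative in the direction [- h] shows that [tau]
itself still has this property, the one in the direction [h] that [tau < 1]
could be exceeded. *)
Lemma segment_increment_le f x h (M : R) :
  (forall t, 0 <= t <= 1 ->
    (exists2 d, `|d| <= M & has_dir_derivative f (x + t *: h) h d) /\
    (exists2 d, `|d| <= M & has_dir_derivative f (x + t *: h) (- h) d)) ->
  `|f (x + h) - f x| <= M.
Proof.
move=> fd; apply/ler_addgt0Pr => e e0.
set K := M + e; pose p t := f (x + t *: h).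
have near_bound t (k : X) d : `|d| <= M ->
    has_dir_derivative f (x + t *: h) k d ->
    \forall a \near 0^'+, `|f (x + t *: h + a *: k) - p t| <= K * a.
  move=> dM fk; have dK : `|d| < K by rewrite /K; lra.
  have dK1 : d < K by rewrite (le_lt_trans _ dK)// ler_norm.
  have dK2 : - d < K by rewrite (le_lt_trans _ dK)// -normrN ler_norm.
  near=> a.
  have a1 : f (x + t *: h + a *: k) - f (x + t *: h) <= K * a.
    by near: a; exact: dir_derivative_near fk dK1.
  have a2 : - f (x + t *: h + a *: k) - - f (x + t *: h) <= K * a.
    by near: a; exact: (dir_derivative_near (dir_derivativeN fk) dK2).
  by rewrite ler_norml a1 andbT /p; lra.
pose E := [set t | 0 <= t <= 1 /\
  forall s, 0 <= s <= t -> `|p s - p 0| <= K * s].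
have E0 : E 0.
  split; first by rewrite lexx ler01.
  by move=> s; rewrite -eq_le => /eqP <-; rewrite subrr normr0 mulr0.
have supE : has_sup E by split; [exists 0|exists 1 => t [/andP[]]].
set tau := sup E.
have tau0 : 0 <= tau by exact: (ub_le_sup (proj2 supE) E0).
have tau1 : tau <= 1 by apply: ge_sup; [exists 0|move=> t [/andP[]]].
have below s : 0 <= s < tau -> `|p s - p 0| <= K * s.
  move=> /andP[s0 st].
  have ts0 : 0 < tau - s by rewrite subr_gt0.
  have [t [_ Et'] st'] := sup_adherent ts0 supE.
  rewrite -/tau subKr in st'.
  by apply: Et'; rewrite s0 ltW.
have Ptau : `|p tau - p 0| <= K * tau.
  have [t0|t0] := leP tau 0.
    have -> : tau = 0 by lra.
    by rewrite subrr normr0 mulr0.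
  have [_ [d dM fk]] := fd tau (introT andP (conj tau0 tau1)).
  have nb := near_bound _ _ _ dM fk.
  near (0 : R)^'+ => a.
  have a0 : 0 < a by [].
  have at' : a < tau by near: a; exact: nbhs_right_lt.
  have := near nb a; rewrite scalerN -addrA -scalerBl => /(_ _) H1.
  have {}H1 : `|p (tau - a) - p tau| <= K * a by apply: H1.
  have H2 := below (tau - a); rewrite subr_ge0 (ltW at') ltrBlDr ltrDl a0 in H2.
  have {}H2 := H2 isT.
  rewrite -[p tau - p 0](subrKA (p (tau - a))) (le_trans (ler_normD _ _))//.
  rewrite distrC; lra.
have [tau_lt1|tau_ge1] := ltP tau 1; last first.
  have tE : tau = 1 by apply/eqP; rewrite eq_le tau1.
  by move: Ptau; rewrite tE mulr1 /p scale1r scale0r addr0.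
have [[d dM fk] _] := fd tau (introT andP (conj tau0 tau1)).
have [r /= r0 nb] := near_bound _ _ _ dM fk.
pose b := Num.min (r / 2) (1 - tau).
have b0 : 0 < b by rewrite lt_min divr_gt0//= subr_gt0.
suff /(ub_le_sup (proj2 supE)) : E (tau + b) by rewrite -/tau; lra.
have b1 : b <= 1 - tau by rewrite ge_min lexx orbT.
have br : b <= r / 2 by rewrite ge_min lexx.
split; first by apply/andP; split; lra.
move=> s /andP[s0 sb]; have [st|st] := ltP s tau; first by apply: below; rewrite s0.
have [->//|sneq] := eqVneq s tau.
have sgt : tau < s by rewrite lt_neqAle eq_sym sneq.
have s2 : 0 < s - tau by rewrite subr_gt0.
have s1 : `|0 - (s - tau)| < r by rewrite sub0r normrN gtr0_norm//; lra.
have := nb _ s1 s2; rewrite /= -addrA -scalerDl [tau + _]addrC subrK => H1.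
rewrite -[p s - p 0](subrKA (p tau)) (le_trans (ler_normD _ _))//.
move: H1; rewrite -/(p s); lra.
Unshelve. all: by end_near. Qed.

End DirectionalDerivative.

(** * Quasidifferentials of nearby points *)

Lemma cvg_sumr {R : realType} {T : Type} {F : set_system T} {FF : Filter F}
    (n : nat) (p : 'I_n -> T -> R) (l : 'I_n -> R) :
  (forall j, p j t @[t --> F] --> l j) ->
  \sum_(j < n) p j t @[t --> F] --> \sum_(j < n) l j.
Proof.
by move=> pl; apply: cvg_big => //; exact: add_continuous.
Qed.

Section Quasidifferentials.
Context {R : realType} {X : normedModType R}.
Implicit Types (f : X -> R) (x h : X) (D : qd X).

Lemma qd_dir_derivative f x D h : is_quasidifferential f x D ->
  exists v w : dual X, [/\ D.1 v, D.2 w,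
    forall v', D.1 v' -> v' h <= v h, forall w', D.2 w' -> w h <= w' h &
    has_dir_derivative f x h (v h + w h)].
Proof.
move=> [_ _ /(_ h)[M [m [[[v Dv <-] vM] [[w Dw <-] wm] fd]]]].
exists v, w; split=> // [v' Dv'|w' Dw']; first by apply: vM; exists v'.
by apply: wm; exists w'.
Qed.

(** The open sets to which outer semicontinuity is applied are the
[e]-neighbourhoods of the sub- and the superdifferential at [x]. *)
Lemma osc_near (U : set X) (D : X -> qd X) x (e : R) : nbhs x U ->
  outer_semicontinuous U D x -> 0 < e ->
  \forall y \near x,
    (forall v, (D y).1 v -> exists2 v0, (D x).1 v0 & `|v - v0| < e) /\
    (forall w, (D y).2 w -> exists2 w0, (D x).2 w0 & `|w - w0| < e).
Proof.
move=> xU osc e0.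
pose enl (A : set (dual X)) := \bigcup_(v0 in A) ball v0 e.
have enl_open A : open (enl A).
  by apply: bigcup_open => v0 _; exact: ball_open.
have sub_enl A : A `<=` enl A by move=> v Av; exists v => //; exact: ballxx.
have [r r0 near_r] := osc _ _ (enl_open _) (enl_open _) (@sub_enl _) (@sub_enl _).
near=> y; have [||D1 D2] := near_r y.
- by near: y.
- near: y; apply/nbhs_normP; exists r => // y /=; by rewrite distrC.
by split=> [v /D1|w /D2] [v0 Dv0]; rewrite -ball_normE/= distrC => ve; exists v0.
Unshelve. all: by end_near. Qed.

(** Near [x] all elements of the quasidifferentials have norm at most [M + 1], so
the directional derivatives along any segment close to [x] are bounded by twice
that times the length of the segment. *)
Lemma osc_lipschitz (f : X -> R) (U : set X) (D : X -> qd X) x (M : R) :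
  nbhs x U -> (forall y, U y -> is_quasidifferential f y (D y)) ->
  outer_semicontinuous U D x ->
  (forall v, (D x).1 v -> `|v| <= M) -> (forall w, (D x).2 w -> `|w| <= M) ->
  exists2 r : R, 0 < r & forall y z, `|y - x| < r -> `|z - x| < r ->
    `|f y - f z| <= (M + M + 2) * `|y - z|.
Proof.
move=> xU fU osc M1 M2.
have /nbhs_normP[r /= r0 near_r] : nbhs x (fun y => U y /\
    (forall v, (D y).1 v -> exists2 v0, (D x).1 v0 & `|v - v0| < 1) /\
    (forall w, (D y).2 w -> exists2 w0, (D x).2 w0 & `|w - w0| < 1)).
  by apply: filterI => //; exact: (osc_near xU osc ltr01).
exists r => // y z yr zr.
set h := y - z; have yE : y = z + h by rewrite addrC subrK.
rewrite [in leLHS]yE.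
apply: segment_increment_le => t /andP[t0 t1].
have [|Ut [Dt1 Dt2]] := near_r (z + t *: h).
  rewrite /=; have -> : x - (z + t *: h) = (1 - t) *: (x - z) + t *: (x - y).
    rewrite scalerBl scale1r opprD addrA -[RHS]addrA; congr (_ + _).
    by rewrite addrC -scalerBr -scalerN /h !opprB [in RHS]addrC addrA subrK.
  rewrite (le_lt_trans (ler_normD _ _))// !normrZ !ger0_norm ?subr_ge0//.
  rewrite ![`|x - _|]distrC.
  have [t00|t00] := leP t 0.
    have -> : t = 0 by lra.
    by rewrite subr0 mul1r mul0r addr0.
  have : t * `|y - x| < t * r by rewrite ltr_pM2l.
  have : (1 - t) * `|z - x| <= (1 - t) * r.
    by apply: ler_wpM2l; [rewrite subr_ge0|exact: ltW].
  lra.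
have bound k : `|k| = `|h| -> exists2 d, `|d| <= (M + M + 2) * `|h| &
    has_dir_derivative f (z + t *: h) k d.
  move=> kh; have [v [w [Dv Dw _ _ fd]]] := qd_dir_derivative k (fU _ Ut).
  exists (v k + w k) => //; rewrite -kh (le_trans (ler_normD _ _))//.
  have bd (u u0 : dual X) : `|u - u0| < 1 -> `|u0| <= M -> `|u k| <= (M + 1) * `|k|.
    move=> uu0 u0M; rewrite (le_trans (dual_norm_ub u k))// ler_wpM2r//.
    rewrite -[u](subrK u0); have := ler_normD (u - u0) u0.
    rewrite /Num.norm/= => /le_trans; apply; rewrite addrC lerD// ltW//.
  have [v0 Dv0 vv0] := Dt1 _ Dv; have [w0 Dw0 ww0] := Dt2 _ Dw.
  have := bd _ _ vv0 (M1 _ Dv0); have := bd _ _ ww0 (M2 _ Dw0); lra.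
by split; apply: bound; rewrite ?normrN.
Qed.

End Quasidifferentials.

(** * The Euclidean norm of a vector of functions *)

Section EuclideanResidual.
Context {R : realType} {X : normedModType R}.

Lemma sqrt_sum_sqr_le n (a : 'I_n -> R) :
  Num.sqrt (\sum_(j < n) a j ^+ 2) <= \sum_(j < n) `|a j|.
Proof.
have S0 : 0 <= \sum_(j < n) `|a j| by exact: sumr_ge0.
rewrite -[leRHS]ger0_norm// -sqrtr_sqr ler_wsqrtr//.
elim: n a S0 => [|n IH] a _; first by rewrite !big_ord0 expr0n.
rewrite !big_ord_recl sqrrD.
have S1 : 0 <= \sum_(j < n) `|a (lift ord0 j)| by exact: sumr_ge0.
rewrite real_normK ?num_real// -addrA lerD2l.
rewrite (le_trans (IH _ S1))// lerDr mulrn_wge0// mulr_ge0//.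
Qed.

Lemma sqrt_sum_sqr_eq0 n (a : 'I_n -> R) :
  Num.sqrt (\sum_(j < n) a j ^+ 2) = 0 -> forall j, a j = 0.
Proof.
move=> /eqP; rewrite sqrtr_eq0 => S j.
have /eqP : \sum_(j < n) a j ^+ 2 = 0.
  by apply/eqP; rewrite eq_le S sumr_ge0// => i _; exact: sqr_ge0.
rewrite psumr_eq0 => [/allP/(_ j)|i _]; last exact: sqr_ge0.
by rewrite mem_index_enum => /(_ isT)/=; rewrite sqrf_eq0 => /eqP.
Qed.

Lemma dir_derivative_sqr (f : X -> R) x h d : has_dir_derivative f x h d ->
  has_dir_derivative (fun y => f y ^+ 2) x h (2 * f x * d).
Proof.
move=> fd; have fc := dir_derivative_cvg fd.
rewrite /has_dir_derivative.
have -> : 2 * f x * d = (f x + f x) * d by ring.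
under eq_fun do rewrite subr_sqr mulrAC mulrC.
apply: cvgM => //; apply: cvgD => //; exact: cvg_cst.
Qed.

(** Away from 0 the derivative is obtained from the one of the square: the
difference quotient of [N ^+ 2], divided by the sum of the two values of [N], is
the difference quotient of [N].  At 0 the quotient is the norm of the vector of
difference quotients. *)
Lemma dir_derivative_euclid n (f : 'I_n -> X -> R) x h (d : 'I_n -> R) :
  (forall j, has_dir_derivative (f j) x h (d j)) ->
  let N y := Num.sqrt (\sum_(j < n) f j y ^+ 2) in
  has_dir_derivative N x h
    (if N x == 0 then Num.sqrt (\sum_(j < n) d j ^+ 2)
     else \sum_(j < n) f j x / N x * d j).
Proof.
move=> fd N.
have S0 y : 0 <= \sum_(j < n) f j y ^+ 2 by apply: sumr_ge0 => j _; exact: sqr_ge0.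
case: eqVneq => [Nx0|Nx0].
  have fx0 := sqrt_sum_sqr_eq0 Nx0.
  have lim : Num.sqrt (\sum_(j < n) ((f j (x + a *: h) - f j x) / a) ^+ 2)
      @[a --> 0^'+] --> Num.sqrt (\sum_(j < n) d j ^+ 2).
    apply: continuous_cvg; first exact: sqrt_continuous.
    by apply: cvg_sumr => j; apply: cvg_sqr; exact: fd.
  refine (near_cvg _ lim); near=> a; have a0 : 0 < a by [].
  have -> : \sum_(j < n) ((f j (x + a *: h) - f j x) / a) ^+ 2 =
      a^-1 ^+ 2 * \sum_(j < n) f j (x + a *: h) ^+ 2.
    rewrite mulr_sumr; apply: eq_bigr => j _.
    by rewrite fx0 subr0 exprMn mulrC.
  by rewrite Nx0 subr0 sqrtrM ?sqr_ge0// sqrtr_sqr gtr0_norm ?invr_gt0// mulrC.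
have N0 : 0 < N x by rewrite lt_neqAle eq_sym Nx0 sqrtr_ge0.
have N2 y : N y ^+ 2 = \sum_(j < n) f j y ^+ 2 by rewrite sqr_sqrtr.
have sd := dir_derivative_sum (fun j => dir_derivative_sqr (fd j)).
have Nc : N (x + a *: h) @[a --> 0^'+] --> N x.
  rewrite /N; apply: continuous_cvg; first exact: sqrt_continuous.
  by apply: cvg_sumr => j; apply: cvg_sqr; exact: (dir_derivative_cvg (fd j)).
have lim : (\sum_(j < n) f j (x + a *: h) ^+ 2 - \sum_(j < n) f j x ^+ 2) / a
    * (N (x + a *: h) + N x)^-1 @[a --> 0^'+] -->
    (\sum_(j < n) 2 * f j x * d j) * (N x + N x)^-1.
  apply: cvgM => //; apply: cvgV; first by rewrite gt_eqF// addr_gt0.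
  by apply: cvgD => //; exact: cvg_cst.
have -> : \sum_(j < n) f j x / N x * d j =
    (\sum_(j < n) 2 * f j x * d j) * (N x + N x)^-1.
  rewrite mulr_suml; apply: eq_bigr => j _; field.
  by rewrite Nx0/= gt_eqF// addr_gt0.
refine (near_cvg _ lim); near=> a; have a0 : 0 < a by [].
rewrite -!N2 subr_sqr mulrAC mulfK//.
by rewrite gt_eqF// ltr_wpDl// sqrtr_ge0.
Unshelve. all: by end_near. Qed.

End EuclideanResidual.

(** * Zeros of a function that can always be decreased *)

Section DescentToZero.
Context {R : realType} {X : completeNormedModType R}.

(** Ekeland's argument.  Let [S x] be the set of points reachable from [x] with a
decrease of slope at least [a].  Starting at [x0], move each time to a point of
[S x] that is at least half as far from [x] as the farthest one.  The values of
[phi] along this sequence decrease and control its increments, so it converges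
to some [z]; as the steps tend to 0, the sets [S (xs n)] shrink to [z], and no
decrease is possible from [z]. *)
Lemma descent_to_zero (phi : X -> R) (x0 : X) (r a : R) : 0 < a ->
  (forall x, 0 <= phi x) -> phi x0 < a * r ->
  (forall x, `|x - x0| < r -> {for x, continuous phi}) ->
  (forall x, `|x - x0| < r -> 0 < phi x ->
     exists2 y, y != x & phi y + a * `|y - x| <= phi x) ->
  exists2 z, phi z = 0 & a * `|z - x0| <= phi x0.
Proof.
move=> a0 phi0 phir cphi desc.
pose S x := [set y | phi y + a * `|y - x| <= phi x].
have S_refl x : S x x by rewrite /S/= subrr normr0 mulr0 addr0.
have S_trans x y z : S x y -> S y z -> S x z.
  rewrite /S/= => xy yz.
  have : `|z - x| <= `|z - y| + `|y - x|.
    by rewrite -[z - x](subrKA y) ler_normD.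
  move=> /(ler_wpM2l (ltW a0)); rewrite mulrDr; lra.
have S_bound x y : S x y -> a * `|y - x| <= phi x.
  by rewrite /S/=; have := phi0 y; lra.
have next x : exists2 y, S x y & forall z, S x z -> `|z - x| <= 2 * `|y - x|.
  pose E := [set `|y - x| | y in S x].
  have supE : has_sup E.
    split; first by exists `|x - x|, x.
    exists (phi x / a) => _ [y Sy <-]; rewrite ler_pdivlMr// mulrC.
    exact: S_bound.
  have [s0|s0] := leP (sup E) 0.
    exists x => // z Sz; rewrite subrr normr0 mulr0 (le_trans _ s0)//.
    by apply: (ub_le_sup (proj2 supE)); exists z.
  have s2 : 0 < sup E / 2 by rewrite divr_gt0.
  have [_ [y Sy <-] ys] := sup_adherent s2 supE.
  exists y => // z Sz; have : `|z - x| <= sup E.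
    by apply: (ub_le_sup (proj2 supE)); exists z.
  by lra.
have [nxt nxtS nxt2] : exists2 nxt : X -> X, (forall x, S x (nxt x)) &
    forall x z, S x z -> `|z - x| <= 2 * `|nxt x - x|.
  have [nxt H] := choice (fun x => let: ex_intro2 y p q := next x in
    ex_intro (fun y => S x y /\ forall z, S x z -> `|z - x| <= 2 * `|y - x|) y (conj p q)).
  by exists nxt => x; have [] := H x.
pose xs n := iter n nxt x0.
have xsS n m : (n <= m)%N -> S (xs n) (xs m).
  move=> /subnKC <-; elim: (m - n)%N => [|k IH]; first by rewrite addn0.
  by rewrite addnS; apply: S_trans IH _; exact: nxtS.
have phi_cvg : cvgn (phi \o xs).
  apply: nonincreasing_is_cvgn.
    move=> n m nm; have := xsS _ _ nm; rewrite /S/=.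
    by have := mulr_ge0 (ltW a0) (normr_ge0 (xs m - xs n)); lra.
  by exists 0 => _ [n _ <-]; exact: phi0.
have xs_cauchy : cauchy (xs @ \oo).
  apply: cauchy_exP => e e0.
  have ae0 : 0 < a * e / 2 by rewrite divr_gt0// mulr_gt0.
  have /cvgrPdist_lt/(_ _ ae0)[N _ HN] := phi_cvg.
  exists (xs N), N => // m /= Nm; rewrite -ball_normE/= distrC.
  have := xsS _ _ Nm; rewrite /S/= => SNm.
  have H1 := HN N (leqnn N); have H2 := HN m Nm.
  rewrite -(ltr_pM2l a0).
  move: H1 H2; rewrite /= !ltr_norml => /andP[? ?] /andP[? ?]; lra.
have [z xz] : exists z : X, xs n @[n --> \oo] --> z.
  exists (lim (xs @ \oo)).
  by apply: cauchy_cvg.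
have norm_cvg x : `|xs n - x| @[n --> \oo] --> `|z - x|.
  by apply: cvg_norm; apply: cvgB => //; exact: cvg_cst.
have az : a * `|z - x0| <= phi x0.
  have lim0 : a * `|xs n - x0| @[n --> \oo] --> a * `|z - x0|.
    by apply: cvgM; [exact: cvg_cst|exact: norm_cvg].
  rewrite -(cvg_lim _ lim0)//; apply: limr_le; first exact: cvgP lim0.
  by apply: nearW => n; apply: S_bound; exact: (xsS 0%N).
have zr : `|z - x0| < r by rewrite -(ltr_pM2l a0) (le_lt_trans az).
have Sz n : S (xs n) z.
  have lim1 : phi (xs m) + a * `|xs m - xs n| @[m --> \oo] -->
      phi z + a * `|z - xs n|.
    apply: cvgD; first exact: (continuous_cvg _ (cphi z zr)).
    by apply: cvgM; [exact: cvg_cst|exact: norm_cvg].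
  rewrite /S/= -(cvg_lim _ lim1)//; apply: limr_le; first exact: cvgP lim1.
  by exists n => // m nm; exact: xsS.
exists z => //; apply/eqP; rewrite eq_le phi0 andbT leNgt; apply/negP => phiz.
have [y yz Szy] := desc z zr phiz.
have lim2 : 2 * `|nxt (xs n) - xs n| @[n --> \oo] --> (0 : R).
  have lim3 : 2 * `|xs n.+1 - xs n| @[n --> \oo] --> 2 * `|z - z|.
    apply: cvgM; first exact: cvg_cst.
    apply: cvg_norm; apply: cvgB => //.
    by rewrite cvg_shiftS.
  by rewrite subrr normr0 mulr0 in lim3.
have : `|y - z| <= 0.
  have lim4 : `|xs n - y| @[n --> \oo] --> `|z - y| by exact: norm_cvg.
  rewrite distrC -(cvg_lim _ lim4)// -(cvg_lim _ lim2)//.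
  apply: ler_lim; [exact: cvgP lim4|exact: cvgP lim2|].
  apply: nearW => n; rewrite distrC; apply: nxt2; apply: S_trans (Sz n) _.
  exact: Szy.
by rewrite normr_le0 subr_eq0; apply/negP.
Qed.

End DescentToZero.

(** * Infeasibility and the constraint qualification *)

Section Descent.
Context {R : realType} {X : completeNormedModType R}.
Implicit Types (x h : X).

(** Unlike the sum of absolute values used by [penalty], the Euclidean norm is
smooth away from 0, so where the equality constraints are violated the derivative
of the norm is a linear combination of those of the [f j], even if some [f j]
vanish.  The sum of absolute values would contribute absolute values of
derivatives, which no direction makes negative. *)
Definition residual l m (f : 'I_l -> X -> R) (g : 'I_m -> X -> R) (x : X) : R :=
  Num.sqrt (\sum_(j < l) f j x ^+ 2) + \sum_(i < m) Num.max (g i x) 0.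

Lemma residual_ge0 l m (f : 'I_l -> X -> R) (g : 'I_m -> X -> R) x :
  0 <= residual f g x.
Proof.
by rewrite addr_ge0 ?sqrtr_ge0// sumr_ge0// => i _; rewrite le_max lexx orbT.
Qed.

Lemma residual_eq0 l m (f : 'I_l -> X -> R) (g : 'I_m -> X -> R) x :
  residual f g x = 0 <-> feasible f g x.
Proof.
have N0 := sqrtr_ge0 (\sum_(j < l) f j x ^+ 2).
have G0 : 0 <= \sum_(i < m) Num.max (g i x) 0.
  by apply: sumr_ge0 => i _; rewrite le_max lexx orbT.
rewrite /residual; split=> [r0|[f0 g0]]; last first.
  rewrite big1 ?sqrtr0 ?add0r => [|j _]; last by rewrite f0 expr0n.
  by rewrite big1// => i _; rewrite max_r.
have N00 : Num.sqrt (\sum_(j < l) f j x ^+ 2) = 0 by lra.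
have /eqP : \sum_(i < m) Num.max (g i x) 0 = 0 by lra.
rewrite psumr_eq0 => [/allP gm|i _]; last by rewrite le_max lexx orbT.
split=> [j|i]; first exact: (sqrt_sum_sqr_eq0 N00).
have := gm i; rewrite mem_index_enum => /(_ isT)/= /eqP.
by move=> <-; rewrite le_max lexx.
Qed.

Lemma residual_le l m (f : 'I_l -> X -> R) (g : 'I_m -> X -> R) x :
  residual f g x <= \sum_(j < l) `|f j x| + \sum_(i < m) Num.max (g i x) 0.
Proof. by rewrite lerD2r sqrt_sum_sqr_le. Qed.

Lemma residual_cvg l m (f : 'I_l -> X -> R) (g : 'I_m -> X -> R) x :
  (forall j, {for x, continuous (f j)}) ->
  (forall i, {for x, continuous (g i)}) ->
  {for x, continuous (residual f g)}.
Proof.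
move=> cf cg; rewrite /continuous_at /residual; apply: cvgD.
  apply: continuous_cvg; first exact: sqrt_continuous.
  by apply: cvg_sumr => j; apply: cvg_sqr; exact: cf.
by apply: cvg_sumr => i; apply: cvg_maxr0; exact: cg.
Qed.

Lemma residual_dir_derivative l m (f : 'I_l -> X -> R) (g : 'I_m -> X -> R)
    x h (d : 'I_l -> R) (e : 'I_m -> R) :
  (forall j, has_dir_derivative (f j) x h (d j)) ->
  (forall i, has_dir_derivative (g i) x h (e i)) ->
  has_dir_derivative (residual f g) x h
    ((if Num.sqrt (\sum_(j < l) f j x ^+ 2) == 0
      then Num.sqrt (\sum_(j < l) d j ^+ 2)
      else \sum_(j < l) f j x / Num.sqrt (\sum_(j < l) f j x ^+ 2) * d j) +
     \sum_(i < m) (if g i x < 0 then 0 else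
                   if g i x == 0 then Num.max (e i) 0 else e i)).
Proof.
move=> fd ge; apply: (dir_derivativeD (dir_derivative_euclid fd)).
exact: (dir_derivative_sum (fun i => dir_derivative_pos_part (ge i))).
Qed.

Lemma osc_continuous_near (f : X -> R) (U : set X) (D : X -> qd X) x :
  nbhs x U -> (forall y, U y -> is_quasidifferential f y (D y)) ->
  outer_semicontinuous U D x -> \forall y \near x, {for y, continuous f}.
Proof.
move=> xU fU osc.
have [[_ _ k1] [_ _ k2] _] := fU _ (nbhs_singleton xU).
have [M1 M10 HM1] := weak_star_compact_bounded k1.
have [M2 M20 HM2] := weak_star_compact_bounded k2.
have [||r r0 lip] := osc_lipschitz (M := M1 + M2) xU fU osc.
- by move=> v /HM1; lra.
- by move=> v /HM2; lra.
set L := M1 + M2 + (M1 + M2) + 2 in lip.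
have L0 : 0 < L by rewrite /L; lra.
near=> y; have yr : `|y - x| < r.
  by near: y; apply/nbhs_normP; exists r => // z /=; rewrite distrC.
apply/cvgrPdist_lt => e e0; near=> z.
rewrite (le_lt_trans (lip y z yr _))//.
  near: z; have xry : 0 < r - `|y - x| by lra.
  apply/nbhs_normP; exists (r - `|y - x|) => // z /= zy.
  have := ler_normD (z - y) (y - x); rewrite subrKA => /le_lt_trans; apply.
  by rewrite distrC; lra.
rewrite -ltr_pdivlMl//; near: z; apply/nbhs_normP.
by exists (L^-1 * e) => //=; rewrite mulr_gt0// invr_gt0.
Unshelve. all: by end_near. Qed.

Lemma cwc_qd_plus (f : X -> R) x D : is_quasidifferential f x D ->
  convex_weak_star_compact (qd_plus D).
Proof. by move=> [? ? _]; exact: cwc_add. Qed.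

(** The main use of outer semicontinuity: near [x] every directional derivative of
[f] is, up to [e * `|h|], the value at [h] of a functional of [qd_plus (D x)],
because it is such a value for the quasidifferential at the nearby point. *)
Lemma osc_dir_derivative (f : X -> R) (U : set X) (D : X -> qd X) x (e : R) :
  nbhs x U -> (forall y, U y -> is_quasidifferential f y (D y)) ->
  outer_semicontinuous U D x -> 0 < e ->
  \forall y \near x, forall h, exists p : dual X * R,
    [/\ qd_plus (D x) p.1, has_dir_derivative f y h p.2 &
        `|p.2 - p.1 h| <= e * `|h|].
Proof.
move=> xU fU osc e0; have e20 : 0 < e / 2 by rewrite divr_gt0.
near=> y; have Uy : U y by near: y.
have [D1 D2] : (forall v, (D y).1 v -> exists2 v0, (D x).1 v0 & `|v - v0| < e / 2) /\
    (forall w, (D y).2 w -> exists2 w0, (D x).2 w0 & `|w - w0| < e / 2).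
  by near: y; exact: (osc_near xU osc e20).
move=> h; have [v [w [Dv Dw _ _ fd]]] := qd_dir_derivative h (fU _ Uy).
have [v0 Dv0 vv0] := D1 _ Dv; have [w0 Dw0 ww0] := D2 _ Dw.
exists (v0 + w0, v h + w h); split=> //; first by exists v0 => //; exists w0.
suff : `|v h + w h - (v0 + w0) h| <= e * `|h| by [].
rewrite dualED opprD addrACA (le_trans (ler_normD _ _))//.
have := dual_norm_ub (v - v0) h; have := dual_norm_ub (w - w0) h.
rewrite !dualED !dualEN => a b; have h0 := normr_ge0 h.
have := ler_wpM2r h0 (ltW vv0); have := ler_wpM2r h0 (ltW ww0).
rewrite /Num.norm/=; rewrite /Num.norm/= in a b h0; lra.
Unshelve. all: by end_near. Qed.

Lemma ereal_inf_gt0 (A : set \bar R) : (0 < ereal_inf A)%E ->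
  exists2 k : R, 0 < k & forall z, A z -> (k%:E < z)%E.
Proof.
case E : (ereal_inf A) => [r| |]//.
  rewrite lte_fin => r0; exists (r / 2); first by rewrite divr_gt0.
  move=> z Az; apply: (@lt_le_trans _ _ r%:E); first by rewrite lte_fin; lra.
  by rewrite -E; exact: ereal_inf_lbound.
move=> _; exists 1 => // z Az; apply: (@lt_le_trans _ _ +oo%E); first exact: ltry.
by rewrite -E; exact: ereal_inf_lbound.
Qed.

(** Compactness makes both halves of the constraint qualification uniform: the
infimum over the unit sphere gives [kappa] and the descent directions for [f];
the maxima of [v hbar] over the finitely many sets [qd_plus (DG i)] with [g i]
active at [x] give [beta]. *)
Lemma mfcq_constants l m (g : 'I_m -> X -> R) x (DF : 'I_l -> qd X)
    (DG : 'I_m -> qd X) :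
  (forall j, convex_weak_star_compact (qd_plus (DF j))) ->
  (forall i, convex_weak_star_compact (qd_plus (DG i))) ->
  qd_MFCQ g x DF DG ->
  exists (kappa beta M : R) (hbar : X), [/\ 0 < kappa, 0 < beta, 0 <= M &
   [/\ forall y : 'cV[R]_l, euclidean_norm y = 1 ->
         exists2 h, `|h| <= 1 & forall v, qd_plus_comb DF y v -> v h < - kappa,
       forall j v, qd_plus (DF j) v -> v hbar = 0,
       forall i v, g i x = 0 -> qd_plus (DG i) v -> v hbar <= - beta &
       forall i v, qd_plus (DG i) v -> `|v| <= M]].
Proof.
move=> cF cG [/ereal_inf_gt0[k k0 kinf] [hbar [hF hG]]].
have /choice[b bP] i : exists b : R, 0 < b /\
    (g i x = 0 -> forall v, qd_plus (DG i) v -> v hbar <= - b).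
  have [gi0|gi0] := pselect (g i x = 0); last first.
    by exists 1; split=> // /gi0.
  have [v Dv vmin] : exists2 v, qd_plus (DG i) v &
      forall w, qd_plus (DG i) w -> - v hbar <= - w hbar.
    apply: (cwc_min (f := fun v => - v hbar)) => // v.
    exact: (cvgN (@weak_star_eval_continuous R X hbar v)).
  exists (- v hbar); split; first by rewrite oppr_gt0; exact: hG Dv.
  by move=> _ w /vmin; rewrite opprK lerN2.
have /choice[M MP] i : exists M : R, 0 <= M /\
    (forall v, qd_plus (DG i) v -> `|v| <= M).
  have [_ _ kG] := cG i.
  by have [M M0 HM] := weak_star_compact_bounded kG; exists M.
exists k, (\big[Order.min/1]_(i < m) b i), (\sum_(i < m) M i), hbar; split=> //.
- by apply: lt_bigmin => // i _; have [] := bP i.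
- by apply: sumr_ge0 => i _; have [] := MP i.
split.
- move=> y y1; apply: uniform_descent; last 2 first.
  + exact: ltW.
  + move=> v yv; have := kinf _ (ex_intro2 _ _ y y1 erefl).
    move=> /lt_le_trans; rewrite -lte_fin; apply.
    by apply: ereal_inf_lbound; exists v.
  by apply: cwc_msum => j; apply: cwc_scale; exact: cF.
- move=> j v Dv.
  have /choice[c Dc] i : exists v, qd_plus (DF i) v by have [] := cF i.
  pose c' i := if i == j then v else c i.
  have Dc' i : qd_plus (DF i) (c' i) by rewrite /c'; case: eqP => [->|].
  (* The multiplier is the [j]-th coordinate vector; the other sets enter with
     an arbitrary element, multiplied by 0. *)
  have vE : (\sum_(i < l) (i == j)%:R *: c' i) hbar = v hbar.
    transitivity (\sum_(i < l) (i == j)%:R * c' i hbar).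
      by rewrite dual_sumE; apply: eq_bigr.
    rewrite (bigD1 j)//= eqxx mul1r big1 ?addr0 ?/c' ?eqxx// => i.
    by move=> /negbTE->; rewrite mul0r.
  rewrite -vE; apply: (hF (\col_i (i == j)%:R)); apply/msumP.
  exists (fun i => (i == j)%:R *: c' i) => // i; rewrite mxE.
  by exists (c' i).
- move=> i v gi0 Dv; have [_ /(_ gi0 v Dv)/le_trans] := bP i; apply.
  by rewrite lerN2; exact: bigmin_le_cond.
- move=> i v Dv; have [_ /(_ v Dv)/le_trans] := MP i; apply.
  rewrite (bigD1 i)//= lerDl; apply: sumr_ge0 => k' _; by have [] := MP k'.
Qed.

End Descent.

(** * Error bound and exact penalty *)

Section ErrorBound.
Context {R : realType} {X : completeNormedModType R} {l m : nat}.
Variables (f : 'I_l -> X -> R) (g : 'I_m -> X -> R) (xbar : X) (U : set X).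
Variables (Df : 'I_l -> X -> qd X) (Dg : 'I_m -> X -> qd X).
Hypothesis U_nbhs : nbhs xbar U.
Hypothesis f_qd : forall j x, U x -> is_quasidifferential (f j) x (Df j x).
Hypothesis g_qd : forall i x, U x -> is_quasidifferential (g i) x (Dg i x).
Hypothesis Df_osc : forall j, outer_semicontinuous U (Df j) xbar.
Hypothesis Dg_osc : forall i, outer_semicontinuous U (Dg i) xbar.
Hypothesis mfcq : qd_MFCQ g xbar (fun j => Df j xbar) (fun i => Dg i xbar).
Hypothesis xbar_feasible : feasible f g xbar.

Lemma continuous_near :
  \forall x \near xbar, (forall j, {for x, continuous (f j)}) /\
    (forall i, {for x, continuous (g i)}).
Proof.
near=> x; split; near: x; apply: filter_forall => i.
  exact: (osc_continuous_near U_nbhs (f_qd i) (@Df_osc i)).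
exact: (osc_continuous_near U_nbhs (g_qd i) (@Dg_osc i)).
Unshelve. all: by end_near. Qed.

(** Every infeasible point near [xbar] has a direction along which the residual
decreases at a rate bounded away from 0.  If [f] does not vanish, this direction
is [hy + T *: hb], where [hy] decreases the norm of [f] and [T] is so large that
the active [g i] decrease as well; otherwise it is [hb], along which [f] is
stationary at [xbar]. *)
Lemma mfcq_descent : exists a H : R, [/\ 0 < a, 0 < H &
  \forall x \near xbar, 0 < residual f g x ->
    exists h d, [/\ `|h| <= H, has_dir_derivative (residual f g) x h d &
      d <= - a]].
Proof.
have Ux := nbhs_singleton U_nbhs.
have [k [b [M [hb [k0 b0 M0 [descF hF hG bG]]]]]] := mfcq_constants
  (fun j => cwc_qd_plus (f_qd j Ux)) (fun i => cwc_qd_plus (g_qd i Ux)) mfcq.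
(* [T] compensates by [T * b = M + 1] the growth of the active [g i] along [hy],
   which is at most [M]; [H] bounds both directions, and the error [e] is such
   that all errors together are at most [c], half of the smallest gain. *)
pose T := (M + 1) / b; pose H := 1 + (T + 1) * `|hb|.
pose c := Num.min 1 (Num.min k b) / 2.
have T0 : 0 < T by rewrite divr_gt0// ltr_wpDl.
have Tb : T * b = M + 1 by rewrite /T divfK// gt_eqF.
have H1 : 1 <= H by rewrite /H lerDl mulr_ge0// addr_ge0// ltW.
have H0 : 0 < H by lra.
have c0 : 0 < c by rewrite divr_gt0// !lt_min ltr01 k0 b0.
have [c1 ck cb] : [/\ 2 * c <= 1, 2 * c <= k & 2 * c <= b].
  have -> : 2 * c = Num.min 1 (Num.min k b) by rewrite /c; field.
  by split; rewrite !ge_min lexx ?orbT.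
pose L : R := l%:R + 1.
have L1 : 1 <= L by rewrite /L lerDr ler0n.
have L0 : 0 < L by lra.
pose e := c / (L * H).
have e0 : 0 < e by rewrite divr_gt0// mulr_gt0.
have eHL : e * H * L = c by rewrite /e; field; rewrite !gt_eqF.
have eH0 : 0 < e * H by rewrite mulr_gt0.
have eHc : e * H <= c by rewrite -eHL ler_peMr// ltW.
exists c, H; split=> //; near=> x => res0.
have DFx : forall j h, exists p : dual X * R,
    [/\ qd_plus (Df j xbar) p.1, has_dir_derivative (f j) x h p.2 &
        `|p.2 - p.1 h| <= e * `|h|].
  near: x; apply: filter_forall => j.
  exact: (osc_dir_derivative U_nbhs (f_qd j) (@Df_osc j) e0).
have DGx : forall i h, exists p : dual X * R,
    [/\ qd_plus (Dg i xbar) p.1, has_dir_derivative (g i) x h p.2 &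
        `|p.2 - p.1 h| <= e * `|h|].
  near: x; apply: filter_forall => i.
  exact: (osc_dir_derivative U_nbhs (g_qd i) (@Dg_osc i) e0).
have active : forall i, 0 <= g i x -> g i xbar = 0.
  near: x; apply: filter_forall => i.
  have [_ gc] := nbhs_singleton continuous_near.
  have [gi0|gi0] := ltP (g i xbar) 0.
    by near=> x; rewrite leNgt => /negP; case; near: x; exact: (cvgr_lt _ (gc i)).
  apply: nearW => x _; apply/eqP; rewrite eq_le gi0 andbT.
  by have [_ ->] := xbar_feasible.
set N := Num.sqrt (\sum_(j < l) f j x ^+ 2).
have near_e h (p : dual X * R) : `|h| <= H ->
    `|p.2 - p.1 h| <= e * `|h| -> `|p.2 - p.1 h| <= e * H.
  by move=> hH /le_trans; apply; rewrite ler_wpM2l// ltW.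
(* The first case is that of a point where only inequalities are violated. *)
have [N0|N0] := eqVneq N 0.
  have hbH : `|hb| <= H.
    by have := mulr_ge0 (ltW T0) (normr_ge0 hb); rewrite /H; lra.
  have /choice[p pP] j := DFx j hb.
  have /choice[q qP] i := DGx i hb.
  have fd j : has_dir_derivative (f j) x hb (p j).2 by have [] := pP j.
  have gd i : has_dir_derivative (g i) x hb (q i).2 by have [] := qP i.
  have rd := residual_dir_derivative fd gd.
  exists hb; eexists; split; [exact: hbH|exact: rd|].
  rewrite -/N N0 eqxx.
  have fpart : Num.sqrt (\sum_(j < l) (p j).2 ^+ 2) <= e * H * l%:R.
    rewrite (le_trans (sqrt_sum_sqr_le _))//.
    rewrite mulr_natr -[X in _ *+ X]card_ord -sumr_const ler_sum// => j _.
    have [Dp _ pe] := pP j; have := near_e _ _ hbH pe.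
    by rewrite (hF _ _ Dp) subr0.
  have gi_le i : g i xbar = 0 -> (q i).2 <= - b + e * H.
    move=> gi0; have [Dq _ qe] := qP i; have := near_e _ _ hbH qe.
    by have := hG _ _ gi0 Dq; rewrite ler_norml => ? /andP[_ ?]; lra.
  have [i0 gi0] : exists i, 0 < g i x.
    apply: contrapT => Ng; move: res0; rewrite lt_neqAle => /andP[/eqP + _].
    apply; apply/esym/residual_eq0; split; first exact: (sqrt_sum_sqr_eq0 N0).
    by move=> i; rewrite leNgt; apply/negP => gi; apply: Ng; exists i.
  rewrite (bigD1 i0)//= ltNge (ltW gi0)/= (gt_eqF gi0).
  have rest : \sum_(i < m | i != i0) (if g i x < 0 then 0 else
      if g i x == 0 then Num.max (q i).2 0 else (q i).2) <= 0.
    apply: sumr_le0 => i _; case: ltP => // gi.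
    have := gi_le _ (active _ gi); case: eqP => _ qi; last by lra.
    by rewrite ge_max lexx andbT; lra.
  have := gi_le _ (active _ (ltW gi0)).
  have : e * H * l%:R + e * H = c by rewrite -eHL /L; ring.
  by lra.
pose y : 'cV[R]_l := \col_j (f j x / N).
have Ngt : 0 < N by rewrite lt_neqAle eq_sym N0 sqrtr_ge0.
have NN : N ^+ 2 = \sum_(j < l) f j x ^+ 2.
  by rewrite sqr_sqrtr// sumr_ge0// => j _; exact: sqr_ge0.
have y1 : euclidean_norm y = 1.
  rewrite /euclidean_norm -[RHS]sqrtr1; congr Num.sqrt.
  under eq_bigr do rewrite mxE exprMn exprVn.
  by rewrite -mulr_suml -NN divff// expf_neq0.
have [hy hy1 hyk] := descF y y1.
pose h := hy + T *: hb.
have hH : `|h| <= H.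
  rewrite (le_trans (ler_normD _ _))// normrZ (gtr0_norm T0) /H mulrDl mul1r.
  by have := normr_ge0 hb; lra.
have /choice[p pP] j := DFx j h.
have /choice[q qP] i := DGx i h.
have fd j : has_dir_derivative (f j) x h (p j).2 by have [] := pP j.
have gd i : has_dir_derivative (g i) x h (q i).2 by have [] := qP i.
have rd := residual_dir_derivative fd gd.
exists h; eexists; split; [exact: hH|exact: rd|].
rewrite -/N (negbTE N0).
have gpart : \sum_(i < m) (if g i x < 0 then 0 else
    if g i x == 0 then Num.max (q i).2 0 else (q i).2) <= 0.
  apply: sumr_le0 => i _; case: ltP => // gi.
  have qi : (q i).2 <= 0.
    have [Dq _ qe] := qP i; have := near_e _ _ hH qe.
    have qb := hG _ _ (active _ gi) Dq.
    have : (q i).1 h = (q i).1 hy + T * (q i).1 hb by rewrite /h linearD linearZ.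
    have : (q i).1 hy <= M.
      rewrite (le_trans (ler_norm _))// (le_trans (dual_norm_ub _ _))//.
      have := ler_wpM2l (dual_norm_ge0 (q i).1) hy1; rewrite mulr1 => /le_trans.
      apply; exact: (bG _ _ Dq).
    have : T * (q i).1 hb <= - (T * b) by rewrite -mulrN ler_wpM2l// ltW.
    by rewrite ler_norml => ? ? -> /andP[_ ?]; lra.
  by case: eqP => _ //; rewrite ge_max qi lexx.
pose v := \sum_(j < l) y j ord0 *: (p j).1.
have vk : v hy < - k.
  apply: hyk; apply/msumP; exists (fun j => y j ord0 *: (p j).1) => // j.
  by have [Dp _ _] := pP j; exists (p j).1.
have vE z : v z = \sum_(j < l) y j ord0 * (p j).1 z.
  by rewrite dual_sumE; apply: eq_bigr.
have vhb : v hb = 0.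
  rewrite vE big1// => j _; have [Dp _ _] := pP j.
  by rewrite (hF _ _ Dp) mulr0.
have fpart : \sum_(j < l) f j x / N * (p j).2 <= v h + e * H * l%:R.
  rewrite vE mulr_natr -[X in _ *+ X]card_ord -sumr_const -big_split ler_sum//= => j _.
  have -> : y j ord0 = f j x / N by rewrite mxE.
  rewrite -lerBlDl -mulrBr (le_trans (ler_norm _))// normrM.
  have [_ _ pe] := pP j.
  rewrite -[leRHS]mul1r ler_pM//; last exact: (near_e _ _ hH pe).
  rewrite normrM normfV (gtr0_norm Ngt) ler_pdivrMr// mul1r.
  rewrite -sqrtr_sqr ler_wsqrtr// (bigD1 j)//= lerDl.
  by apply: sumr_ge0 => i _; exact: sqr_ge0.
have vh : v h = v hy + T * v hb by rewrite /h linearD linearZ.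
rewrite vhb mulr0 addr0 in vh.
have : e * H * l%:R + e * H = c by rewrite -eHL /L; ring.
by lra.
Unshelve. all: by end_near. Qed.

Lemma error_bound : exists2 K : R, 0 < K &
  \forall x \near xbar, exists2 z, feasible f g z &
    `|z - x| <= K * residual f g x.
Proof.
have [a [H [a0 H0 descent]]] := mfcq_descent.
have /nbhs_normP[r /= r0 near_r] : nbhs xbar (fun x =>
   (0 < residual f g x -> exists h d, [/\ `|h| <= H,
      has_dir_derivative (residual f g) x h d & d <= - a]) /\
   {for x, continuous (residual f g)}).
  apply: filterI => //; apply: filterS continuous_near => x [cf cg].
  exact: residual_cvg.
(* Half of the slope is lost when passing from the derivative to a finite
   step, and [H] converts the parameter of the step into its length. *)
pose b := a / 2 / H; have b0 : 0 < b by rewrite !divr_gt0.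
have bH : b * H = a / 2 by rewrite /b divfK// gt_eqF.
exists b^-1; first by rewrite invr_gt0.
have r20 : 0 < r / 2 by rewrite divr_gt0.
have res_cvg : residual f g x @[x --> xbar] --> residual f g xbar.
  have [] := near_r xbar; last by [].
  by rewrite /= subrr normr0.
have res_bar : residual f g xbar = 0 by apply/residual_eq0.
near=> x.
have xr : `|x - xbar| < r / 2.
  by near: x; apply/nbhs_normP; exists (r / 2) => // y /=; rewrite distrC.
have near_x y : `|y - x| < r / 2 -> `|xbar - y| < r.
  move=> yx; have := ler_normD (y - x) (x - xbar).
  by rewrite subrKA distrC; lra.
have [||y yx||z z0 zx] := @descent_to_zero R X (residual f g) x (r / 2) b b0.
- exact: residual_ge0.
- near: x; apply: (cvgr_lt _ res_cvg); rewrite res_bar mulr_gt0//.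
- by have [] := near_r y (near_x _ yx).
- move=> y yx y0; have [/(_ y0)[h [d [hH hd da]]] _] := near_r y (near_x _ yx).
  have da2 : d < - (a / 2) by lra.
  near (0 : R)^'+ => t; have t0 : 0 < t by [].
  have dec : residual f g (y + t *: h) - residual f g y <= - (a / 2) * t.
    by near: t; exact: (dir_derivative_near hd da2).
  exists (y + t *: h).
    apply/eqP => yE; move: dec; rewrite yE subrr.
    by have := mulr_gt0 a0 t0; lra.
  have -> : y + t *: h - y = t *: h by rewrite addrAC subrr add0r.
  rewrite normrZ (gtr0_norm t0).
  have : b * (t * `|h|) <= a / 2 * t.
    by rewrite -bH mulrCA [leRHS]mulrC !ler_pM2l.
  by lra.
exists z; first by apply/residual_eq0.
by rewrite ler_pdivlMl.
Unshelve. all: by end_near. Qed.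

(** Near [xbar], a point [x] is within [K * residual f g x] of a feasible [z], and
[z] is close enough to [xbar] to be compared with it; the Lipschitz property of
[u] bounds the difference between [u x] and [u z]. *)
Lemma exact_penalty (u : X -> R) : lipschitz_near u xbar ->
  locally_optimal u f g xbar ->
  exists2 cstar : R, 0 <= cstar & forall c, cstar <= c ->
    \forall x \near xbar, penalty u f g c xbar <= penalty u f g c x.
Proof.
move=> [V xV [L0 [L0r lipV]]] [_ opt].
have [K K0 eb] := error_bound.
pose L := `|L0| + 1.
have lip y z : V y -> V z -> `|u y - u z| <= L * `|y - z|.
  move=> Vy Vz; apply: (lipV L _ (y, z)) => //.
  by rewrite /L; have := ler_norm L0; lra.
have L00 : 0 <= L by rewrite addr_ge0.
exists (L * K); first by rewrite mulr_ge0// ltW.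
move=> c cLK.
have /nbhs_normP[r /= r0 near_r] : nbhs xbar (fun x =>
   V x /\ (feasible f g x -> u xbar <= u x)) by exact: filterI.
have [cf cg] := nbhs_singleton continuous_near.
have res_cvg : residual f g x @[x --> xbar] --> residual f g xbar.
  exact: residual_cvg.
have res_bar : residual f g xbar = 0 by apply/residual_eq0.
have pen_bar : penalty u f g c xbar = u xbar.
  case: xbar_feasible => f0 g0; rewrite /penalty big1 ?add0r => [|j _]; last first.
    by rewrite f0 normr0.
  by rewrite big1 ?mulr0 ?addr0// => i _; rewrite max_r.
near=> x; rewrite pen_bar.
have xr : `|x - xbar| < r / 2.
  near: x; apply/nbhs_normP; exists (r / 2) => /=; first by rewrite divr_gt0.
  by move=> y; rewrite /= distrC.
have Kr : K * residual f g x < r / 2.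
  rewrite -ltr_pdivlMl//; near: x; apply: (cvgr_lt _ res_cvg).
  by rewrite res_bar mulr_gt0 ?invr_gt0 ?divr_gt0.
have [z fz zx] : exists2 z, feasible f g z & `|z - x| <= K * residual f g x.
  by near: x.
have [|Vz /(_ fz) uz] := near_r z.
  rewrite /= distrC; have := ler_normD (z - x) (x - xbar); rewrite subrKA; lra.
have [|Vx _] := near_r x; first by rewrite /= distrC; lra.
have uzx : u z - u x <= L * K * residual f g x.
  rewrite (le_trans (ler_norm _))// (le_trans (lip _ _ Vz Vx))//.
  by rewrite -mulrA ler_wpM2l.
rewrite /penalty.
have := residual_le f g x; have r_ge0 := residual_ge0 f g x.
set P := (_ + _) => resP.
have LK0 : 0 <= L * K by rewrite mulr_ge0// ltW.
have := ler_wpM2l LK0 resP; have := ler_wpM2r (le_trans r_ge0 resP) cLK.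
by lra.
Unshelve. all: by end_near. Qed.

End ErrorBound.

(** * Necessary conditions *)

Section Multipliers.
Context {R : realType} {X : normedModType R}.
Implicit Types (A B : set (dual X)) (h x : X).

Lemma qd_minimum (f : X -> R) x (D : qd X) : is_quasidifferential f x D ->
  (\forall y \near x, f x <= f y) ->
  forall w, D.2 w -> (D.1 + [set w])%MK 0.
Proof.
move=> fD fmin w Dw; have [D1 _ _] := fD.
apply: zero_in_cwc; first by apply: cwc_add => //; exact: cwc_set1.
move=> h; have [v [w' [Dv _ _ wmin fd]]] := qd_dir_derivative h fD.
exists (v + w); first by exists v => //; exists w.
have := dir_derivative_ge0 fd fmin; have := wmin _ Dw.
by rewrite dualED; lra.
Qed.

Lemma segment_hull_max A B a b h : A a -> B b ->
  exists2 v, segment_hull A B v & a h <= v h /\ b h <= v h.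
Proof.
move=> Aa Bb; have [ab|ba] := leP (a h) (b h).
  exists b => //; exists 0, a, b; split=> //; first by rewrite lexx ler01.
  by rewrite scale0r subr0 scale1r add0r.
exists a; last by rewrite lexx ltW.
exists 1, a, b; split=> //; first by rewrite lexx ler01.
by rewrite subrr scale1r scale0r addr0.
Qed.

Context {l m : nat} (u : X -> R) (f : 'I_l -> X -> R) (g : 'I_m -> X -> R).
Context (x : X) (Du : qd X) (Df : 'I_l -> qd X) (Dg : 'I_m -> qd X).

(** Fixing the selections turns each minimum over a superdifferential into a linear
term, at the price of an inequality.  So the derivative of the penalty function
is bounded by the support function of a Minkowski sum: an absolute value
becomes the maximum of the support functions of [A j] and [B j], hence that of
their hull, and the positive part of an active [g i] that of the hull of [C i]
and 0.  Inactive [g i] do not contribute to the derivative, which gives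
complementarity. *)
Lemma penalty_multipliers (c : R) (w0 : dual X) (v w : 'I_l -> dual X)
    (z : 'I_m -> dual X) :
  0 <= c -> is_quasidifferential u x Du ->
  (forall j, is_quasidifferential (f j) x (Df j)) ->
  (forall i, is_quasidifferential (g i) x (Dg i)) ->
  feasible f g x ->
  (\forall y \near x, penalty u f g c x <= penalty u f g c y) ->
  Du.2 w0 -> (forall j, (Df j).1 (v j)) -> (forall j, (Df j).2 (w j)) ->
  (forall i, (Dg i).2 (z i)) ->
  exists (mu_low mu_up : 'I_l -> R) (lam : 'I_m -> R),
    [/\ forall j, 0 <= mu_low j /\ 0 <= mu_up j,
        forall i, 0 <= lam i /\ lam i * g i x = 0,
        (Du.1 + [set w0]
         - \msum_(j < l) (mu_low j *: ([set v j] + (Df j).2))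
         + \msum_(j < l) (mu_up j *: ((Df j).1 + [set w j]))
         + \msum_(i < m) (lam i *: ((Dg i).1 + [set z i])))%MK 0,
        forall j, mu_low j + mu_up j <= c
      & forall i, lam i <= c].
Proof.
move=> c0 uD fD gD [fx gx] pmin Dw0 Dv Dw Dz.
pose A j := ((Df j).1 + [set w j])%MK.
pose B j := (-1 *: ([set v j] + (Df j).2))%MK.
pose C i := ((Dg i).1 + [set z i])%MK.
pose E i := if g i x < 0 then [set 0] else (c *: segment_hull (C i) [set 0])%MK.
have cA j : convex_weak_star_compact (A j).
  by have [? _ _] := fD j; apply: cwc_add => //; exact: cwc_set1.
have cB j : convex_weak_star_compact (B j).
  by have [_ ? _] := fD j; apply: cwc_scale; apply: cwc_add => //; exact: cwc_set1.
have cC i : convex_weak_star_compact (C i).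
  by have [? _ _] := gD i; apply: cwc_add => //; exact: cwc_set1.
have cE i : convex_weak_star_compact (E i).
  rewrite /E; case: ifP => _; first exact: cwc_set1.
  by apply: cwc_scale; apply: cwc_segment_hull => //; exact: cwc_set1.
have cU : convex_weak_star_compact (Du.1 + [set w0])%MK.
  by have [? _ _] := uD; apply: cwc_add => //; exact: cwc_set1.
have : (Du.1 + [set w0] + \msum_(j < l) (c *: segment_hull (A j) (B j))
    + \msum_(i < m) E i)%MK 0.
  apply: zero_in_cwc => [|h].
    apply: cwc_add; last exact: cwc_msum.
    apply: cwc_add => //; apply: cwc_msum => j; apply: cwc_scale.
    exact: cwc_segment_hull.
  have [u1 [w1 [Du1 _ _ w1min ud]]] := qd_dir_derivative h uD.
  have /choice[p pP] j : exists p : dual X * R,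
      [/\ segment_hull (A j) (B j) p.1, has_dir_derivative (f j) x h p.2 &
          `|p.2| <= p.1 h].
    have [v1 [w2 [Dv1 Dw2 v1max w2min fd]]] := qd_dir_derivative h (fD j).
    have [||q Hq [q1 q2]] := @segment_hull_max (A j) (B j) (v1 + w j)
      (-1 *: (v j + w2)) h.
    - by exists v1 => //; exists (w j).
    - by exists (v j + w2) => //; exists (v j) => //; exists w2.
    exists (q, v1 h + w2 h); split=> //.
    move: q1 q2; rewrite dualEZ !dualED ler_norml => q1 q2.
    have vj := v1max _ (Dv j); have wj := w2min _ (Dw j).
    suff H : - q h <= v1 h + w2 h <= q h by [].
    by apply/andP; split; lra.
  have /choice[q qP] i : exists q : dual X * R,
      [/\ E i q.1, has_dir_derivative (fun y => Num.max (g i y) 0) x h q.2 &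
          c * q.2 <= q.1 h].
    have [v1 [w2 [Dv1 Dw2 v1max w2min gd]]] := qd_dir_derivative h (gD i).
    have := dir_derivative_pos_part gd; rewrite /E; case: ltP => gi gd'.
      by exists (0, 0); split=> //=; rewrite mulr0.
    have gi0 : g i x = 0 by apply/eqP; rewrite eq_le gi gx.
    rewrite gi0 eqxx in gd'.
    have [||s Hs [s1 s2]] := @segment_hull_max (C i) [set 0] (v1 + z i) 0 h => //.
      by exists v1 => //; exists (z i).
    exists (c *: s, Num.max (v1 h + w2 h) 0); split=> //; first by exists s.
    suff : c * Num.max (v1 h + w2 h) 0 <= (c *: s) h by [].
    rewrite dualEZ ler_wpM2l// ge_max; apply/andP; split; last exact: s2.
    move: s1; rewrite dualED; have := w2min _ (Dz i); lra.
  have fd j : has_dir_derivative (fun y => `|f j y|) x h `|(p j).2|.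
    by have [_ fd _] := pP j; exact: dir_derivative_norm0.
  have gd i : has_dir_derivative (fun y => Num.max (g i y) 0) x h (q i).2.
    by have [] := qP i.
  have pd := dir_derivativeD ud (dir_derivativeZ (c := c) (dir_derivativeD
    (dir_derivative_sum fd) (dir_derivative_sum gd))).
  have d0 := dir_derivative_ge0 pd pmin.
  exists ((u1 + w0) + \sum_(j < l) c *: (p j).1 + \sum_(i < m) (q i).1).
    exists ((u1 + w0) + \sum_(j < l) c *: (p j).1).
      exists (u1 + w0); first by exists u1 => //; exists w0.
      exists (\sum_(j < l) c *: (p j).1) => //; apply/msumP.
      exists (fun j => c *: (p j).1) => // j; exists (p j).1 => //.
      by have [] := pP j.
    exists (\sum_(i < m) (q i).1) => //; apply/msumP.
    by exists (fun i => (q i).1) => // i; have [] := qP i.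
  rewrite !dualED !dual_sumE.
  have sf : c * \sum_(j < l) `|(p j).2| <= \sum_(j < l) (c *: (p j).1) h.
    rewrite mulr_sumr ler_sum// => j _; have [_ _ pj] := pP j.
    by rewrite dualEZ ler_wpM2l.
  have sg : c * \sum_(i < m) (q i).2 <= \sum_(i < m) (q i).1 h.
    by rewrite mulr_sumr ler_sum// => i _; have [] := qP i.
  have := w1min _ Dw0; rewrite mulrDr in d0; lra.
move=> [_ [a0 Ua0 [_ /msumP[p pP ->] <-]] [_ /msumP[q qP ->]]].
have /choice[P PP] j : exists P : R * (dual X * dual X),
    [/\ 0 <= P.1 <= 1, A j P.2.1, ([set v j] + (Df j).2)%MK P.2.2 &
      p j = (c * P.1) *: P.2.1 - (c * (1 - P.1)) *: P.2.2].
  have [s [t [a [_ [t01 Aa [b Bb <-] ->]]]] <-] := pP j.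
  exists (t, (a, b)); split=> //=.
  by rewrite scaleN1r scalerN scalerDr scalerN !scalerA.
have /choice[Q QP] i : exists Q : R * dual X,
    [/\ 0 <= Q.1 <= c, Q.1 * g i x = 0, C i Q.2 & q i = Q.1 *: Q.2].
  have := qP i; rewrite /E; case: ltP => [gi ->|gi [_ [t [a [_ [t01 Ca -> ->]]]] <-]].
    have [[a Ca] _ _] := cC i; exists (0, a); split=> //=.
    - by rewrite lexx.
    - by rewrite mul0r.
    - by rewrite scale0r.
  exists (c * t, a); case/andP: t01 => t0 t1; split=> //=.
  - by rewrite mulr_ge0//= ler_piMr.
  - have -> : g i x = 0 by apply/eqP; rewrite eq_le gi gx.
    by rewrite mulr0.
  - by rewrite scaler0 addr0 scalerA.
move=> sum0.
exists (fun j => c * (1 - (P j).1)), (fun j => c * (P j).1), (fun i => (Q i).1).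
split.
- move=> j; have [/andP[P0 P1] _ _ _] := PP j.
  by rewrite !mulr_ge0// subr_ge0.
- by move=> i; have [/andP[-> _] -> _ _] := QP i.
- exists (a0 - \sum_(j < l) (c * (1 - (P j).1)) *: (P j).2.2
    + \sum_(j < l) (c * (P j).1) *: (P j).2.1).
    exists (a0 - \sum_(j < l) (c * (1 - (P j).1)) *: (P j).2.2).
      exists a0 => //.
      exists (- \sum_(j < l) (c * (1 - (P j).1)) *: (P j).2.2) => //.
      exists (\sum_(j < l) (c * (1 - (P j).1)) *: (P j).2.2); last by rewrite scaleN1r.
            apply/msumP; exists (fun j => (c * (1 - (P j).1)) *: (P j).2.2) => // j.
      by exists (P j).2.2 => //; have [] := PP j.
    exists (\sum_(j < l) (c * (P j).1) *: (P j).2.1) => //.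
    apply/msumP; exists (fun j => (c * (P j).1) *: (P j).2.1) => // j.
    by exists (P j).2.1 => //; have [] := PP j.
  exists (\sum_(i < m) q i).
    apply/msumP; exists q => // i; have [_ _ Ci ->] := QP i.
    by exists (Q i).2.
  rewrite -[RHS]sum0; congr (_ + _); rewrite -addrA; congr (_ + _).
  rewrite addrC -sumrB; apply: eq_bigr => j _.
  by have [_ _ _ ->] := PP j.
- by move=> j; rewrite -mulrDr subrK mulr1.
- by move=> i; have [/andP[]] := QP i.
Qed.

End Multipliers.

Theorem theorem3 (R : realType) (X : completeNormedModType R) (l m : nat)
    (u : X -> R) (f : 'I_l -> X -> R) (g : 'I_m -> X -> R) (xbar : X)
    (U : set X) (Du : qd X) (Df : 'I_l -> X -> qd X) (Dg : 'I_m -> X -> qd X)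
    (xbar_opt : locally_optimal u f g xbar)
    (u_qd : is_quasidifferential u xbar Du)
    (u_lip : lipschitz_near u xbar)
    (U_nbhs : nbhs xbar U)
    (f_qd : forall j x, U x -> is_quasidifferential (f j) x (Df j x))
    (g_qd : forall i x, U x -> is_quasidifferential (g i) x (Dg i x))
    (Df_osc : forall j, outer_semicontinuous U (Df j) xbar)
    (Dg_osc : forall i, outer_semicontinuous U (Dg i) xbar)
    (mfcq : qd_MFCQ g xbar (fun j => Df j xbar) (fun i => Dg i xbar)) :
  exists cstar : R,
    [/\ 0 <= cstar,
        forall (c : R) (DPsi : qd X), cstar <= c ->
          is_quasidifferential (penalty u f g c) xbar DPsi ->
          forall w : dual X, DPsi.2 w -> (DPsi.1 + [set w])%MK 0
      & forall (w0 : dual X) (v w : 'I_l -> dual X) (z : 'I_m -> dual X),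
          Du.2 w0 ->
          (forall j, (Df j xbar).1 (v j)) ->
          (forall j, (Df j xbar).2 (w j)) ->
          (forall i, (Dg i xbar).2 (z i)) ->
          exists (mu_low mu_up : 'I_l -> R) (lam : 'I_m -> R),
            [/\ forall j, 0 <= mu_low j /\ 0 <= mu_up j,
                forall i, 0 <= lam i /\ lam i * g i xbar = 0,
                (Du.1 + [set w0]
                 - \msum_(j < l) (mu_low j *: ([set v j] + (Df j xbar).2))
                 + \msum_(j < l) (mu_up j *: ((Df j xbar).1 + [set w j]))
                 + \msum_(i < m) (lam i *: ((Dg i xbar).1 + [set z i])))%MK 0,
                forall j, mu_low j + mu_up j <= cstar
              & forall i, lam i <= cstar]].
Proof.
have xU := nbhs_singleton U_nbhs.
have [feas _] := xbar_opt.
have [c0 c00 pen] := exact_penalty U_nbhs f_qd g_qd Df_osc Dg_osc mfcq feas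
  u_lip xbar_opt.
exists c0; split=> // [c DPsi cc0 psi_qd w Dw|w0 v w z Dw0 Dv Dw Dz].
  exact: (qd_minimum psi_qd (pen c cc0)).
have fD j := f_qd j _ xU; have gD i := g_qd i _ xU.
exact: (penalty_multipliers c00 u_qd fD gD feas (pen c0 (lexx c0)) Dw0 Dv Dw Dz).
Qed.
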